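(* Let $G_n\sim G(n,p)$ with $p=p(n)=n^{-\alpha+o(1)}$ for a constant $\alpha>0$, and let $X_n$ denote the maximum number of edges of a chordal subgraph of $G_n$. (1) If $\alpha\in(1/2,1]$ and $\alpha\notin\{\frac{1+k}{1+2k}:k\in\mathbb{Z}_{\geq0}\}$, then $X_n/n\to\frac{1+2k_\alpha}{1+k_\alpha}$ in probability, where $k_\alpha$ is the largest integer $k\ge 0$ such that $\alpha<\frac{1+k}{1+2k}$. (2) If $\alpha\in(0,1/2]$, then $X_n/n\to1/\alpha$ in probability.
   Context: A graph is chordal if it contains no induced cycle of length at least 4. $G(n,p)$ is the binomial random graph on vertex set $[n]$ in which each pair is an edge independently with probability $p$. *)

(* Defs.v *)
From HB Require Import structures.
From mathcomp Require Import all_boot all_order all_algebra.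
From mathcomp Require Import all_classical all_reals all_analysis.
Set Implicit Arguments. Unset Strict Implicit. Unset Printing Implicit Defensive.
Import Order.TTheory GRing.Theory Num.Theory.
Import numFieldNormedType.Exports.
Local Open Scope ring_scope.

(* Graphs on vertex set 'I_n (= [n]) are given by their edge set,
   a set of 2-element subsets of 'I_n. *)
Definition pairs (n : nat) : {set {set 'I_n}} := [set e : {set 'I_n} | #|e| == 2%N].

Definition adj (n : nat) (H : {set {set 'I_n}}) (x y : 'I_n) : bool :=
  (x != y) && ([set x; y] \in H).

Definition has_induced_cycle_ge4 (n : nat) (H : {set {set 'I_n}}) : Prop :=
  exists (k : nat) (f : 'I_k -> 'I_n),
    [/\ (4 <= k)%N, injective f &
        forall i j : 'I_k, i != j ->
          (adj H (f i) (f j) <->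
             ((j : nat) = (i.+1 %% k)%N \/ (i : nat) = (j.+1 %% k)%N))].

Definition chordal (n : nat) (H : {set {set 'I_n}}) : Prop :=
  ~ has_induced_cycle_ge4 H.

Definition max_chordal (n : nat) (E : {set {set 'I_n}}) : nat :=
  (\max_(H : {set {set 'I_n}} | (H \subset E) && `[< chordal H >]) #|H|)%N.

Definition gnp_prob (R : realType) (n : nat) (p : R)
    (A : {set {set 'I_n}} -> bool) : R :=
  \sum_(E : {set {set 'I_n}} | (E \subset pairs n) && A E)
     p ^+ #|E| * (1 - p) ^+ (#|pairs n| - #|E|).

Definition cvg_in_prob_gnp (R : realType) (p : nat -> R)
    (X : forall n : nat, {set {set 'I_n}} -> R) (c : R) : Prop :=
  forall eps : R, 0 < eps ->
    ((fun n : nat => gnp_prob (p n) (fun E => eps < `|X n E - c|)) @ \oo --> 0)%classic.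

Definition exponent_is (R : realType) (p : nat -> R) (alpha : R) : Prop :=
  exists eps : nat -> R, (eps @ \oo --> 0)%classic /\
    forall n : nat, (2 <= n)%N -> p n = powR (n%:R) (- alpha + eps n).

Definition Xn_over_n (R : realType) (n : nat) (E : {set {set 'I_n}}) : R :=
  (max_chordal E)%:R / n%:R.

(* Main.v *)
Require Import Defs.
From mathcomp Require Import all_boot all_order all_algebra.
From mathcomp Require Import all_classical all_reals all_analysis.
From mathcomp Require Import fintype finset zify ring lra.
Import Order.TTheory GRing.Theory Num.Theory.
Set Implicit Arguments. Unset Strict Implicit. Unset Printing Implicit Defensive.
Local Open Scope ring_scope.

(** A chordal graph has a vertex ranking in which the lower neighbours of every
    vertex form a clique, so its edges can be counted vertex by vertex.

    Upper bounds are first-moment estimates. With high probability cliques of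
    [G(n,p)] have bounded size, and chordal graphs of bounded clique size number
    only [n^(n+o(n))], since a lower neighbourhood is determined by its
    highest-ranked vertex and a bounded amount of information; this gives
    [1/alpha]. For [alpha > 1/2] the ranking splits the edges into clusters, a
    cluster on [s] vertices having at least [2 s - 3] edges: clusters exceeding
    the ratio [(2 k + 1) / (k + 1)] of edges to [s - 1] have bounded size, and
    there are only [o(n)] of them.

    For the lower bounds take [A / B < 1 / alpha] and a large chordal graph in
    which every [s] vertices span at most [(s - 1) A / B] edges, with equality up
    to a constant for the whole graph. By Janson's inequality every linear-size
    vertex set contains a copy with high probability, so disjoint copies can be
    packed greedily. *)

(* [zify] inspects the whole context; dropping the non-arithmetic hypotheses
   first makes [lia] an order of magnitude faster. *)
Ltac nlia :=
  repeat match goal with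
  | H : ?P |- _ =>
    lazymatch P with
    | is_true (leq _ _) => fail
    | is_true (leq _ _ && leq _ _) => fail
    | @eq bool (leq _ _) _ => fail
    | @eq ?T _ _ => first [unify T nat; fail 1 | clear H]
    | is_true (@eq_op _ _ _) => fail
    | is_true (~~ (@eq_op _ _ _)) => fail
    | _ => clear H
    end
  end; lia.

(** * Expectations and probabilities for binomial random subsets *)

Section RandomSubset.
Context {R : realType} {T : finType}.
Implicit Types (D A E : {set T}) (p : R) (f g : {set T} -> R).

(** For [alpha > 1/2] counting all chordal graphs only gives [1 / alpha], which is above the limit:
    the obstruction is local. A piece with [s] vertices and [2 s - 3] edges has about
    [n ^ (s - alpha (2 s - 3))] copies. The exponent decreases in [s], so pieces have bounded size;
    at [s = k + 3] it is below [1], leaving [o(n)] copies, exactly when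
    [alpha > (k + 2) / (2 k + 3)]. A piece on at most [k + 2] vertices beats the ratio
    [(2 k + 1) / (k + 1)] only with [2 s - 2] edges, and is then rare as well. This places the jumps
    of the limit; the jump values of [alpha] are excluded because both tails need a strict margin to
    absorb [n ^ o(1)].

    In the lower bound, the density condition gives every subpattern on at least two vertices an
    expected number of copies of order at least [n ^ (1 + d)] with [d > 0], so the Janson exponent
    can be a multiple of [n] that beats the union bound over [2 ^ n] vertex sets. The construction
    requires [2 B <= A + 1]: an equality for [A = 2 k + 1], [B = k + 1], and true for the best
    fraction with denominator [B] below [1 / alpha] when [alpha <= 1/2]. *)

Definition Ex D p g : R :=
  \sum_(E : {set T} | E \subset D) p ^+ #|E| * (1 - p) ^+ (#|D| - #|E|) * g E.

Lemma eq_Ex D p f g : (forall E, E \subset D -> f E = g E) -> Ex D p f = Ex D p g.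
Proof. by move=> fg; apply: eq_bigr => E /fg ->. Qed.

Lemma ExD D p f g : Ex D p (fun E => f E + g E) = Ex D p f + Ex D p g.
Proof. by rewrite -big_split /=; apply: eq_bigr => E _; rewrite mulrDr. Qed.

Lemma ExZ D p c g : Ex D p (fun E => c * g E) = c * Ex D p g.
Proof. by rewrite mulr_sumr; apply: eq_bigr => E _; rewrite mulrCA. Qed.

Lemma Ex_sum D p (I : finType) (P : pred I) (f : I -> {set T} -> R) :
  Ex D p (fun E => \sum_(i | P i) f i E) = \sum_(i | P i) Ex D p (f i).
Proof. by rewrite exchange_big /=; apply: eq_bigr => E _; rewrite mulr_sumr. Qed.

Lemma le_Ex D p f g : 0 <= p <= 1 ->
  (forall E, E \subset D -> f E <= g E) -> Ex D p f <= Ex D p g.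
Proof.
move=> /andP[p0 p1] fg; apply: ler_sum => E /fg fgE.
by apply: ler_wpM2l => //; rewrite mulr_ge0 // exprn_ge0 // subr_ge0.
Qed.

Lemma Ex_split D p g e : e \in D ->
  Ex D p g = p * Ex (D :\ e) p (fun E => g (e |: E)) + (1 - p) * Ex (D :\ e) p g.
Proof.
move=> eD; rewrite /Ex (bigID (fun E : {set T} => e \in E)) /=; congr (_ + _).
  rewrite (reindex_onto (fun E => e |: E) (fun E => E :\ e)) /=; last first.
    by move=> E /andP[_ eE]; rewrite setD1K.
  rewrite mulr_sumr; apply: eq_big => [E|E].
    rewrite setU11 andbT subUset sub1set eD /= subsetD1; congr (_ && _).
    apply/eqP/idP => [<-|eE]; first by rewrite setD11.
    by rewrite setU1K.
  move=> /andP[_ /eqP eE].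
  have {}eE : e \notin E by rewrite -eE setD11.
  rewrite cardsU1 eE add1n exprS (cardsD1 e D) eD subSS; ring.
rewrite mulr_sumr; apply: eq_big => [E|E].
  by rewrite subsetD1.
move=> /andP[ED eE].
have leE : (#|E| <= #|D :\ e|)%N by apply: subset_leq_card; rewrite subsetD1 ED.
rewrite (cardsD1 e D) eD add1n subSn // exprS; ring.
Qed.

Lemma Ex_set0 p g : Ex set0 p g = g set0.
Proof.
rewrite /Ex (big_pred1 set0) => [|E]; last by rewrite subset0.
by rewrite cards0 expr0 subnn expr0 !mul1r.
Qed.

Lemma Ex_cst D p c : Ex D p (fun=> c) = c.
Proof.
have [n] := ubnP #|D|; elim: n D => // n IHn D Dn.
have [->|[e eD]] := set_0Vmem D; first by rewrite Ex_set0.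
rewrite (Ex_split _ _ eD) !IHn; first ring.
all: by rewrite (cardsD1 e D) eD in Dn.
Qed.

(** Conditioning on [A \subset E] leaves the other elements independent. Redrawing the elements of
    [A] on the right is harmless, since the union absorbs them. *)
Lemma Ex_supset D p A g : A \subset D ->
  Ex D p (fun E => (A \subset E)%:R * g E) = p ^+ #|A| * Ex D p (fun E => g (A :|: E)).
Proof.
have [n] := ubnP #|A|; elim: n A g => // n IHn A g An AD.
have [->|[e eA]] := set_0Vmem A.
  rewrite cards0 expr0 mul1r; apply: eq_Ex => E _.
  by rewrite sub0set mul1r set0U.
have eD := subsetP AD _ eA.
have split E : A \subset E = (e \in E) && (A :\ e \subset E).
  by rewrite -{1}(setD1K eA) subUset sub1set.
transitivity (Ex D p (fun E => (A :\ e \subset E)%:R * ((e \in E)%:R * g E))).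
  by apply: eq_Ex => E _; rewrite split; case: (e \in E); case: (_ \subset _); rewrite ?mul0r ?mul1r ?mulr0.
rewrite IHn; last 2 first.
- by rewrite (cardsD1 e A) eA in An.
- exact: subset_trans (subsetDl _ _) AD.
rewrite (cardsD1 e A) eA add1n exprSr -mulrA; congr (_ * _).
rewrite (Ex_split _ _ eD) (Ex_split _ (fun E => g _) eD).
have -> : Ex (D :\ e) p (fun E => (e \in A :\ e :|: E)%:R * g (A :\ e :|: E)) = 0.
  rewrite -[RHS](Ex_cst (D :\ e) p); apply: eq_Ex => E.
  by rewrite subsetD1 => /andP[_ /negPf eE]; rewrite in_setU setD11 eE mul0r.
have -> : Ex (D :\ e) p (fun E => (e \in A :\ e :|: (e |: E))%:R * g (A :\ e :|: (e |: E)))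
   = Ex (D :\ e) p (fun E => g (A :|: E)).
  apply: eq_Ex => E _; rewrite !inE eqxx /= mul1r; congr g.
  by rewrite setUCA setUA setD1K.
have -> : Ex (D :\ e) p (fun E => g (A :|: (e |: E)))
   = Ex (D :\ e) p (fun E => g (A :|: E)).
  apply: eq_Ex => E _; congr g.
  by rewrite setUA; congr (_ :|: _); rewrite setUC; apply/setUidPr; rewrite sub1set.
ring.
Qed.

Definition Pr D p (P : pred {set T}) : R := Ex D p (fun E => (P E)%:R).

Lemma Pr_supset D p A : A \subset D -> Pr D p (fun E => A \subset E) = p ^+ #|A|.
Proof.
move=> AD; transitivity (Ex D p (fun E => (A \subset E)%:R * 1)).
  by apply: eq_Ex => E _; rewrite mulr1.
by rewrite (@Ex_supset D p A (fun=> 1)) // Ex_cst mulr1.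
Qed.

Lemma Pr_ge0 D p P : 0 <= p <= 1 -> 0 <= Pr D p P.
Proof.
by move=> p01; rewrite -[leLHS](Ex_cst D p); apply: le_Ex.
Qed.

Lemma le_Pr D p (P Q : pred {set T}) : 0 <= p <= 1 ->
  (forall E, E \subset D -> P E -> Q E) -> Pr D p P <= Pr D p Q.
Proof.
move=> p01 PQ; apply: le_Ex => // E ED; rewrite ler_nat.
by case: (P E) (PQ E ED) => // ->.
Qed.

Lemma PrU_le D p (P Q : pred {set T}) : 0 <= p <= 1 ->
  Pr D p (fun E => P E || Q E) <= Pr D p P + Pr D p Q.
Proof.
move=> p01; rewrite /Pr -ExD; apply: le_Ex => // E ED.
by rewrite -natrD ler_nat; case: (P E); case: (Q E).
Qed.

Lemma Pr_exists_le D p (I : finType) (C : pred I) (P : I -> pred {set T}) : 0 <= p <= 1 ->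
  Pr D p (fun E => [exists i, C i && P i E]) <= \sum_(i | C i) Pr D p (P i).
Proof.
move=> p01; rewrite /Pr -Ex_sum; apply: le_Ex => // E ED.
case: existsP => [[i /andP[Ci Pi]]|_]; last by apply: sumr_ge0.
by rewrite (bigD1 i) //= Pi lerDl; apply: sumr_ge0.
Qed.

Lemma markov_Ex D p g (c : R) : 0 <= p <= 1 -> 0 < c -> (forall E, 0 <= g E) ->
  Pr D p (fun E => c <= g E) <= c^-1 * Ex D p g.
Proof.
move=> p01 c0 g0; rewrite -ExZ; apply: le_Ex => // E ED.
rewrite ler_pdivlMl //.
by case: (leP c (g E)) => /= ?; rewrite ?mulr1 ?mulr0.
Qed.

Lemma Ex_exists_ge D p g (c : R) : 0 <= p <= 1 -> c <= Ex D p g -> exists2 E : {set T}, E \subset D & c <= g E.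
Proof.
move=> p01 cg; apply: contrapT => H.
have lt E : E \subset D -> g E < c by move=> ED; rewrite ltNge; apply/negP => ?; apply: H; exists E.
have [E0 ED0 leE0] : exists2 E : {set T}, E \subset D & forall F : {set T}, F \subset D -> g F <= g E.
  case: (@arg_maxP _ _ _ set0 (fun E => E \subset D) g (sub0set _)) => E ED leE.
  by exists E => // F /leE.
have : Ex D p g <= g E0 by rewrite -[leRHS](Ex_cst D p); apply: le_Ex.
by move=> /(le_trans cg); rewrite leNgt lt.
Qed.

End RandomSubset.

(** * Janson's inequality in a sparsified form *)

Section Janson.
Context {R : realType} {T : finType}.
Variables (D : {set T}) (p : R) (I : finType) (A : I -> {set T}).
Hypotheses (p01 : 0 <= p <= 1) (AD : forall i, A i \subset D).

Definition edge_meet (i j : I) : bool := (j != i) && (A i :&: A j != set0).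

Let avoids (s : seq I) (E : {set T}) := all (fun i => ~~ (A i \subset E)) s.

Let avoidsU s E F : avoids s (E :|: F) -> avoids s F.
Proof.
by apply: sub_all => i; apply: contra => /subset_trans; apply; apply: subsetUr.
Qed.

(* Conditioning on [A i] present turns [E] into [A i :|: E]: this leaves
   avoidance of the sets disjoint from [A i] unchanged. *)
Let avoids_step i s : i \notin s ->
  Pr D p (avoids (i :: s)) <=
  Pr D p (avoids s) *
    (1 - (p ^+ #|A i| - \sum_(j <- s | edge_meet i j) p ^+ #|A i :|: A j|)).
Proof.
move=> nis; set x := p ^+ #|A i| - _.
set F := avoids [seq j <- s | ~~ edge_meet i j].
have leF : Pr D p (avoids s) <= Pr D p F.
  apply: le_Pr => // E _ /allP H; apply/allP => j.
  by rewrite mem_filter => /andP[_ /H].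
(* [F] is a decreasing event, so forcing [B] into the random set cannot make it more likely. *)
have FE (B : {set T}) : B \subset D ->
    Ex D p (fun E => (B \subset E)%:R * (F E)%:R) <= p ^+ #|B| * Pr D p F.
  move=> BD; rewrite Ex_supset //; apply: ler_wpM2l.
    by rewrite exprn_ge0 //; case/andP: p01.
  apply: le_Ex => // E _; rewrite ler_nat.
  by case FE : (F (B :|: E)) => //; rewrite [F E](avoidsU FE).
have FA : Ex D p (fun E => (A i \subset E)%:R * (F E)%:R) = p ^+ #|A i| * Pr D p F.
  rewrite Ex_supset //; congr (_ * _); apply: eq_Ex => E _; congr (_%:R).
  congr nat_of_bool; apply/eq_in_all => j; rewrite mem_filter => /andP[+ js].
  have ji : j != i by apply: contraNneq nis => <-.
  rewrite /edge_meet ji /= negbK => /eqP ij0; congr (~~ _).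
  apply/idP/idP => [sub|/subset_trans]; last by apply; apply: subsetUr.
  apply/subsetP => e ej; have := subsetP sub e ej; rewrite inE => /orP[ei|//].
  by have := in_set0 e; rewrite -ij0 inE ei ej.
have key : Pr D p F * x <= Pr D p (fun E => (A i \subset E) && avoids s E).
  rewrite mulrBr mulrC -FA lerBlDr.
  have le1 : Ex D p (fun E => (A i \subset E)%:R * (F E)%:R) <=
    Ex D p (fun E => ((A i \subset E) && avoids s E)%:R +
      \sum_(j <- s | edge_meet i j) (A i :|: A j \subset E)%:R * (F E)%:R).
    apply: le_Ex => // E _.
    have sum0 : 0 <= \sum_(j <- s | edge_meet i j) (A i :|: A j \subset E)%:R * (F E)%:R :> R.
      by apply: sumr_ge0 => j _; rewrite mulr_ge0.
    case Ai : (A i \subset E); last by rewrite mul0r add0r.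
    case FEE : (F E); last first.
      by rewrite mulr0 addr_ge0 ?ler0n // sumr_ge0 // => j _; rewrite mulr0.
    case av : (avoids s E); first by rewrite /= mul1r lerDl sumr_ge0 // => j _; rewrite mulr1.
    move/negbT: av => /allPn[j js]; rewrite negbK => Aj.
    have mj : edge_meet i j.
      apply: contraT => nm; move/allP: FEE => /(_ j).
      by rewrite mem_filter nm js Aj => /(_ isT).
    rewrite /= mul1r add0r (big_rem j js) /= mj mulr1 subUset Ai Aj lerDl.
    by apply: sumr_ge0.
  apply: (le_trans le1); rewrite ExD lerD2l.
  rewrite [leLHS](_ : _ = \sum_(j <- s | edge_meet i j)
      Ex D p (fun E => (A i :|: A j \subset E)%:R * (F E)%:R)); last first.
    elim: (s) => [|j t IH].
      rewrite big_nil -[RHS](Ex_cst D p); apply: eq_Ex => E _.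
      by rewrite big_nil.
    rewrite big_cons -IH; case: ifP => mj; last first.
      by apply: eq_Ex => E _; rewrite big_cons mj.
    by rewrite -ExD; apply: eq_Ex => E _; rewrite big_cons mj.
  rewrite mulr_sumr; apply: ler_sum => j _.
  by rewrite mulrC; apply: FE; rewrite subUset !AD.
have -> : Pr D p (avoids (i :: s)) =
    Pr D p (avoids s) - Pr D p (fun E => (A i \subset E) && avoids s E).
  apply/eqP; rewrite eq_sym subr_eq; apply/eqP; rewrite -ExD; apply: eq_Ex => E _ /=.
  by case: (A i \subset E); case: (avoids s E); rewrite /= ?addr0 ?add0r.
(* For negative [x] the factor [1 - x] exceeds one and the bound is trivial. *)
have [x0|x0] := leP 0 x.
  rewrite mulrBr mulr1 lerD2l lerN2; apply: le_trans key.
  exact: ler_wpM2r.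
apply: (@le_trans _ _ (Pr D p (avoids s) * 1)).
  by rewrite mulr1 gerBl Pr_ge0.
by rewrite ler_wpM2l ?Pr_ge0 // lerBrDr gerDl ltW.
Qed.

(** The step bounds multiply through [1 - x <= expR (- x)]. They charge each meeting pair once; the
    ordered double sum counts it twice, which only weakens the bound. *)
Let avoids_expR s : uniq s ->
  Pr D p (avoids s) <= expR (- (\sum_(i <- s) p ^+ #|A i| -
    \sum_(i <- s) \sum_(j <- s | edge_meet i j) p ^+ #|A i :|: A j|)).
Proof.
have p0 : 0 <= p by case/andP: p01.
elim: s => [|i s IH] /= => [_|/andP[nis us]].
  by rewrite !big_nil subrr oppr0 expR0 /Pr Ex_cst.
apply: le_trans (avoids_step nis) _.
set x := p ^+ #|A i| - _.
apply: (@le_trans _ _ (Pr D p (avoids s) * expR (- x))).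
  by rewrite ler_wpM2l ?Pr_ge0 //; apply: expR_ge1Dx.
apply: (le_trans (ler_wpM2r (expR_ge0 _) (IH us))).
rewrite -expRD ler_expR -opprD lerN2 /x !big_cons /=.
have le2 : \sum_(i0 <- s) \sum_(j <- s | edge_meet i0 j) p ^+ #|A i0 :|: A j| <=
   \sum_(j <- s) \sum_(j0 <- i :: s | edge_meet j j0) p ^+ #|A j :|: A j0|.
  apply: ler_sum => j _; rewrite big_cons; case: ifP => // _.
  by rewrite lerDr exprn_ge0.
have -> : edge_meet i i = false by rewrite /edge_meet eqxx.
move: le2; lra.
Qed.

(** Keep each index with probability [q]: the linear term scales by [q], the pair term by [q ^+ 2],
    and some set [J] of indices does at least as well as the average. Avoiding every set implies
    avoiding those indexed by [J]. A small [q] tames a dominating pair term. *)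
Lemma janson (q : R) : 0 <= q <= 1 ->
  Pr D p (fun E => [forall i, ~~ (A i \subset E)]) <=
  expR (- (q * \sum_i p ^+ #|A i| -
    q ^+ 2 * \sum_i \sum_(j | edge_meet i j) p ^+ #|A i :|: A j|)).
Proof.
move=> q01.
pose g (J : {set I}) := \sum_i (i \in J)%:R * p ^+ #|A i| -
  \sum_i \sum_(j | edge_meet i j) ((i \in J) && (j \in J))%:R * p ^+ #|A i :|: A j|.
set c := q * _ - _.
have memE i : Ex [set: I] q (fun J => (i \in J)%:R) = q.
  rewrite -[RHS]expr1 -(cards1 i) -(Pr_supset q (subsetT [set i])).
  by apply: eq_Ex => J _; rewrite sub1set.
have mem2E i j : edge_meet i j -> Ex [set: I] q (fun J => ((i \in J) && (j \in J))%:R) = q ^+ 2.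
  move=> /andP[ji _]; have <- : #|[set i; j]| = 2%N by rewrite cards2 eq_sym ji.
  rewrite -(Pr_supset q (subsetT _)).
  by apply: eq_Ex => J _; rewrite subUset !sub1set.
have gc : c <= Ex [set: I] q g.
  rewrite le_eqVlt; apply/orP; left; apply/eqP; rewrite /g.
  under [RHS]eq_Ex => J _ do rewrite -mulN1r.
  rewrite ExD ExZ mulN1r !Ex_sum /c !mulr_sumr; congr (_ - _).
    apply: eq_bigr => i _; under [RHS]eq_Ex => J _ do rewrite mulrC.
    by rewrite ExZ memE mulrC.
  apply: eq_bigr => i _; rewrite Ex_sum mulr_sumr; apply: eq_bigr => j mij.
  under [RHS]eq_Ex => J _ do rewrite mulrC.
  by rewrite ExZ mem2E // mulrC.
have [J _ cJ] := Ex_exists_ge q01 gc.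
apply: (@le_trans _ _ (Pr D p (avoids (enum J)))).
  by apply: le_Pr => // E _ /forallP H; apply/allP => i _; apply: H.
apply: le_trans (avoids_expR (enum_uniq J)) _.
rewrite ler_expR lerN2 (le_trans cJ) // /g !big_enum /= lerB //.
  rewrite [leRHS]big_mkcond; apply: ler_sum => i _.
  by case: (i \in J); rewrite ?mul1r ?mul0r.
rewrite big_mkcond; apply: ler_sum => i _.
case: (i \in J) => /=; last by apply: sumr_ge0 => j _; rewrite mul0r.
rewrite big_enum_cond big_mkcondl [leRHS]big_mkcond [leLHS]big_mkcond; apply: ler_sum => j _.
by case: (edge_meet i j); case: (j \in J); rewrite ?mul1r ?mul0r.
Qed.
End Janson.

(** * Simplicial vertices and perfect rankings of chordal graphs *)

Section Chordal.
Context {n : nat}.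
Implicit Types (H : {set {set 'I_n}}) (x y z s : 'I_n) (U C : {set 'I_n}).
Local Open Scope nat_scope.

Lemma adjC H x y : adj H x y = adj H y x.
Proof. by rewrite /adj eq_sym finset.setUC. Qed.

Lemma adjxx H x : adj H x x = false.
Proof. by rewrite /adj eqxx. Qed.

(** Chords shortcut the walk from [y1] to [y2] through [C], so a chordless one may be assumed.
    Closing it at [s], whose only neighbours on it are its ends, gives an induced cycle; it has
    length at least 4 because [y1] and [y2] are not adjacent. *)
Lemma induced_cycle H s y1 y2 (C : pred 'I_n) (c : seq 'I_n) :
  ~~ adj H y1 y2 -> y1 != y2 ->
  adj H s y1 -> adj H s y2 -> (forall x, C x -> ~~ adj H s x) -> ~~ C s ->
  ~~ C y1 -> ~~ C y2 ->
  all C c -> path (adj H) y1 (rcons c y2) -> has_induced_cycle_ge4 H.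
Proof.
move=> n12 d12 sy1 sy2 nsC nCs nC1 nC2 Cc pc.
have [m le_m] := ubnP (size c); elim: m c Cc pc le_m => // m IH c Cc pc le_m.
set p := rcons c y2 in pc; set P := y1 :: p.
have szp : size p = (size c).+1 by rewrite size_rcons.
have nthc i : i < size c -> nth s p i \in c.
  by move=> ic; rewrite nth_rcons ic mem_nth.
have nthL : nth s p (size c) = y2 by rewrite nth_rcons ltnn eqxx.
have [[i [j [ij jP chord]]]|nochord] := pselect
  (exists i j, [/\ i.+1 < j, j < size P & adj H (nth s P i) (nth s P j)]).
  case: j ij jP chord => // j ij; rewrite /= szp => jc chord.
  apply: (IH (take i c ++ drop j c)).
  - by rewrite all_cat; apply/andP; split; apply/allP => x; [move/mem_take|move/mem_drop]; move/(allP Cc).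
  - have -> : rcons (take i c ++ drop j c) y2 = take i p ++ drop j p.
      rewrite rcons_cat /p drop_rcons //.
      by rewrite -[rcons c y2]cats1 takel_cat //; nlia.
    have jp : j < size p by rewrite szp.
    have ip : i <= size p by rewrite szp; nlia.
    have pi : path (adj H) y1 (take i p) by apply: take_path.
    rewrite cat_path pi /=.
    move: pc; rewrite -{1}(cat_take_drop j p) cat_path (drop_nth s jp) /= => /and3P[_ _ ->].
    rewrite andbT (last_nth s) size_takel //.
    move: chord; rewrite (_ : nth s P i = nth s (y1 :: take i p) i) //.
    by case: (i) => //= i'; rewrite nth_take.
  - rewrite size_cat size_takel; last by nlia.
    by rewrite size_drop; nlia.
have nadj i j : i.+1 < j -> j < size P -> adj H (nth s P i) (nth s P j) = false.
  by move=> ij jP; apply/negP => a; apply: nochord; exists i, j.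
have adj1 i : i < size p -> adj H (nth s P i) (nth s P i.+1).
  by move=> ip; apply: (pathP s pc).
(* A repeated vertex is joined to the successor of its second occurrence, a chord from the first.
   The last vertex [y2] has no successor, but it differs from [y1] and lies outside [C]. *)
have uP : uniq P.
  apply/(uniqPn s) => -[i [j [ij jP e]]].
  have := jP; rewrite /= szp ltnS leq_eqVlt => /orP[/eqP jL|jL].
    have {}jL : j = (size c).+1 by nlia.
    move: e; rewrite jL /= nthL; case: i ij => [|i] ij /= e; first by rewrite e eqxx in d12.
    have ic : i < size c by nlia.
    by have := allP Cc _ (nthc i ic); rewrite e (negPf nC2).
  have := adj1 j; rewrite szp => /(_ _); rewrite -e nadj //= ?szp; try nlia.
have sP : s \notin P.
  rewrite inE mem_rcons inE !negb_or; apply/and3P; split.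
  - by apply: contraTneq sy1 => <-; rewrite adjxx.
  - by apply: contraTneq sy2 => <-; rewrite adjxx.
  - by apply/negP => /(allP Cc); apply/negP.
have c0 : 0 < size c.
  by rewrite lt0n; apply/negP => /eqP/size0nil c0; move: pc; rewrite /p c0 /= (negPf n12).
have key i j : i < j -> j < (size P).+1 ->
    adj H (nth s (s :: P) i) (nth s (s :: P) j) = (j == i.+1) || ((i == 0) && (j == size P)).
  case: j => // j; case: i => [_|i ij] jP.
    rewrite [nth s (s :: P) 0]/= [nth s (s :: P) j.+1]/= -/P eqSS eqxx /=.
    case: j jP => [|j] jP; first by rewrite sy1.
    have [jc|jc] := ltnP j (size c).
      rewrite /= (negPf (nsC _ (allP Cc _ (nthc j jc)))) /= szp; nlia.
    have -> : j = size c by move: jP; rewrite /= szp; nlia.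
    by rewrite /= nthL sy2 szp eqxx.
  rewrite [nth s (s :: P) i.+1]/= [nth s (s :: P) j.+1]/= -/P eqSS /= orbF.
  have [->|ne] := eqVneq j i.+1.
    by apply: adj1; move: ij jP; rewrite /= szp; nlia.
  by rewrite nadj //; nlia.
exists (size P).+1, (fun i : 'I_(size P).+1 => nth s (s :: P) i); split.
- by rewrite /= szp; nlia.
- move=> i j /eqP; rewrite nth_uniq //=; first by move/eqP/val_inj.
  by rewrite sP.
- have modS (a b : 'I_(size P).+1) : a < b -> a.+1 %% (size P).+1 = a.+1.
    by move=> ab; rewrite modn_small //; have := ltn_ord b; nlia.
  have modL (b : 'I_(size P).+1) :
      b.+1 %% (size P).+1 = if b == size P :> nat then 0 else b.+1.
    case: eqVneq => [->|ne]; first by rewrite modnn.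
    by rewrite modn_small //; have := ltn_ord b; nlia.
  have main (i j : 'I_(size P).+1) : i < j ->
    (adj H (nth s (s :: P) i) (nth s (s :: P) j) <->
      (j : nat) = i.+1 %% (size P).+1 \/ (i : nat) = j.+1 %% (size P).+1).
    move=> ij; rewrite key // (modS i j) // modL.
    by case: (eqVneq (j : nat) (size P)) => [jL|jL]; split; move: ij; nlia.
  move=> i j nij; have /orP[ij|ij] : (i < j) || (j < i) by rewrite -neq_ltn.
    exact: main.
  by rewrite adjC; have := main _ _ ij; tauto.
Qed.

Definition simplicial H U s : Prop :=
  forall y z, y \in U -> z \in U -> y != z -> adj H s y -> adj H s z -> adj H y z.

Definition linked H C : Prop :=
  forall x y, x \in C -> y \in C ->
    exists c, [/\ all (mem C) c, path (adj H) x c & last x c = y].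

Lemma linked1 H x : linked H [set x].
Proof. by move=> y z /set1P-> /set1P->; exists [::]. Qed.

Lemma linkedU1 H C y w : linked H C -> w \in C -> adj H y w -> linked H (y |: C).
Proof.
move=> lC wC yw; have sub c : all (mem C) c -> all (mem (y |: C)) c.
  by apply: sub_all => z /= zC; rewrite inE zC orbT.
move=> a b; rewrite !inE => /orP[/eqP->|aC] /orP[/eqP->|bC].
- by exists [::].
- have [c [Cc pc lc]] := lC w b wC bC.
  by exists (w :: c); rewrite /= sub // yw pc andbT; split=> //; apply: setU1r.
- have [c [Cc pc lc]] := lC a w aC wC.
  exists (rcons c y); rewrite all_rcons sub // rcons_path last_rcons pc lc adjC yw.
  by rewrite andbT; split=> //; apply: setU11.
- by have [c [Cc pc lc]] := lC a b aC bC; exists c; rewrite sub.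
Qed.

Definition has_remote H U C : Prop :=
  [/\ C \subset U, linked H C, C != finset.set0 &
      exists2 z, z \in U :\: C & {in C, forall c, ~~ adj H z c}].

(* Dirac: for a maximal linked [C] with a nonempty remote part [R], every
   neighbour of [C] is joined to all of [R], so a simplicial vertex of [R] is
   simplicial in [U]; two non-adjacent neighbours of [C] would close an induced
   cycle through [C]. *)
Lemma chordal_simplicial H U :
  chordal H -> U != finset.set0 -> exists2 s, s \in U & simplicial H U s.
Proof.
move=> chH; have [m] := ubnP #|U|; elim: m U => // m IH U Um /set0Pn[u uU].
have [cl|ncl] := pselect (forall x y, x \in U -> y \in U -> x != y -> adj H x y).
  by exists u => // y z yU zU yz _ _; apply: cl.
have [x [y [xU yU xy nxy]]] : exists x y, [/\ x \in U, y \in U, x != y & ~~ adj H x y].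
  apply: contrapT => nE; apply: ncl => x y xU yU xy.
  by apply/negPn/negP => nxy; apply: nE; exists x, y.
have P0 : `[< has_remote H U [set x] >].
  apply/asboolP; split; rewrite ?sub1set //; first exact: linked1.
    by apply/set0Pn; exists x; rewrite set11.
  exists y; first by rewrite !inE yU eq_sym xy.
  by move=> c /set1P->; rewrite adjC.
case: (@arg_maxnP _ [set x] (fun C => `[< has_remote H U C >]) (fun C => #|C|) P0).
move=> C /asboolP[CU lC /set0Pn[c0 c0C] [z0]]; rewrite inE => /andP[z0C z0U] z0n maxC.
pose R := [set z in U :\: C | [forall c in C, ~~ adj H z c]].
have RP z : reflect [/\ z \in U, z \notin C & {in C, forall c, ~~ adj H z c}] (z \in R).
  rewrite !inE; apply: (iffP andP) => [[/andP[zC zU] /forall_inP H1]//|[zU zC H1]].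
  by rewrite zC zU; split=> //; apply/forall_inP.
have [s sR sS] : exists2 s, s \in R & simplicial H R s.
  apply: IH; last by apply/set0Pn; exists z0; apply/RP.
  apply: leq_trans (_ : #|U| <= m); last by rewrite -ltnS.
  apply: proper_card; apply/properP; split.
    by apply/subsetP => z /RP[].
  by exists c0; [apply: (subsetP CU)|apply/negP => /RP[_]; rewrite c0C].
have [sU sC sn] := RP _ sR.
exists s => //.
have nbr z : z \in U -> z \notin C -> z \notin R -> exists2 c, c \in C & adj H z c.
  move=> zU zC; apply: contraNP => nE; apply/RP; split=> // c cC.
  by apply/negP => zc; apply: nE; exists c.
have join z r : z \in U -> z \notin C -> z \notin R -> r \in R -> adj H z r.
  move=> zU zC zR rR; have [c cC zc] := nbr _ zU zC zR.
  have [rU rC rn] := RP _ rR.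
  apply/negPn/negP => nzr.
  (* If [z] missed [r], then [z |: C] would still be linked with [r] remote from it, against the
     maximality of [C]. *)
  have : #|z |: C| <= #|C|.
    apply: maxC; apply/asboolP; split.
    - by rewrite subUset sub1set zU.
    - exact: linkedU1 zc.
    - by apply/set0Pn; exists z; rewrite setU11.
    - exists r; first by rewrite !inE negb_or rC rU !andbT; apply: contraNneq zR => <-.
      move=> d; rewrite !inE => /orP[/eqP->|/rn//].
      by rewrite adjC.
  by rewrite cardsU1 zC ltnn.
have outC z : adj H s z -> z \notin C by apply: contraTN => /sn.
move=> y1 y2 y1U y2U y12 s1 s2.
have [R1|R1] := boolP (y1 \in R); have [R2|R2] := boolP (y2 \in R).
- exact: sS.
- by rewrite adjC; apply: join => //; apply: outC.
- by apply: join => //; apply: outC.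
apply/negPn/negP => n12; apply: chH.
have [a1 a1C ya1] := nbr _ y1U (outC _ s1) R1.
have [a2 a2C ya2] := nbr _ y2U (outC _ s2) R2.
have [c [Cc pc lc]] := lC _ _ a1C a2C.
apply: (@induced_cycle H s y1 y2 (mem C) (a1 :: c)) => //=.
- exact: outC.
- exact: outC.
- by rewrite a1C.
- by rewrite ya1 rcons_path pc lc adjC.
Qed.

(** Ranks may coincide, so that disjoint copies of a pattern can be ranked independently; a strict
    order is obtained by adding injectivity where it is wanted. *)
Definition perfect_rank H (r : 'I_n -> nat) : Prop :=
  forall x y z, y != z -> adj H x y -> adj H x z -> r y <= r x -> r z <= r x -> adj H y z.

(** The two cycle neighbours of a vertex of highest rank on an induced cycle would be adjacent,
    which is impossible when the cycle has length at least 4. *)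
Lemma perfect_rank_chordal H r : perfect_rank H r -> chordal H.
Proof.
move=> rH [k [f [k4 finj fadj]]].
case: k k4 f finj fadj => // k k4 f finj fadj.
case: (@arg_maxnP _ (ord0 : 'I_k.+1) predT (fun i => r (f i)) isT) => i _ maxi.
pose a := ordS i; pose b := ord_pred i.
have va : a = i.+1 %% k.+1 :> nat by [].
have vb : b = (i + k.+1).-1 %% k.+1 :> nat by [].
have ik := ltn_ord i.
have vb' : (b : nat) = if i == 0 :> nat then k else i.-1.
  rewrite vb; case: eqVneq => [->|i0]; first by rewrite add0n modn_small.
  by rewrite (_ : (i + k.+1).-1 = i.-1 + k.+1) ?modnDr ?modn_small //; nlia.
have va' : (a : nat) = if i == k :> nat then 0 else i.+1.
  by rewrite va; case: eqVneq => [->|i0]; rewrite ?modnn // modn_small //; nlia.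
have mS (c : 'I_k.+1) : c.+1 %% k.+1 = if c == k :> nat then 0 else c.+1.
  by case: eqVneq => [->|i0]; rewrite ?modnn // modn_small //; have := ltn_ord c; nlia.
clearbody a b.
have natP (c d : 'I_k.+1) : (c : nat) <> d -> c != d by move=> ne; apply/eqP => e; apply: ne; rewrite e.
have ia : i != a by apply: natP; rewrite va'; move: k4 ik; case: eqP; nlia.
have ib : i != b by apply: natP; rewrite vb'; move: k4 ik; case: eqP; nlia.
have ab : a != b.
  by apply: natP; rewrite vb' va'; move: k4 ik; do 2 case: eqP; nlia.
have aa : adj H (f i) (f a) by apply/(fadj _ _ ia); left; rewrite va.
have ab' : adj H (f i) (f b).
  apply/(fadj _ _ ib); right; rewrite mS vb'; move: k4 ik; do 2 case: eqP; nlia.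
have : adj H (f a) (f b).
  apply: (rH (f i)) => //; try exact: maxi.
  by apply: contraNneq ab => /finj->.
move/(fadj _ _ ab); rewrite !mS va' vb'.
by move: k4 ik; do 4 case: eqP => //=; nlia.
Qed.

End Chordal.

(** * Lower neighbourhoods and parents *)

Section Elimination.
Context {n : nat}.
Implicit Types (H : {set {set 'I_n}}) (x y z s v : 'I_n) (U C : {set 'I_n}).
Implicit Types (r : 'I_n -> nat).
Local Open Scope nat_scope.

(** A simplicial vertex of [U] gets the top rank, above a ranking of the other vertices of [U]. *)
Lemma chordal_perfect_rank H : chordal H -> exists2 r, injective r & perfect_rank H r.
Proof.
move=> chH.
suff [r [ri _ rp]] : exists r, [/\ {in [set: 'I_n] &, injective r},
    {in [set: 'I_n], forall x, r x < #|[set: 'I_n]|} &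
    forall x y z, x \in [set: 'I_n] -> y \in [set: 'I_n] -> z \in [set: 'I_n] -> y != z ->
      adj H x y -> adj H x z -> r y <= r x -> r z <= r x -> adj H y z].
  exists r => [x y|x y z]; first by apply: ri; rewrite inE.
  by move=> *; apply: (rp x); rewrite ?inE.
have [m] := ubnP #|[set: 'I_n]|; elim: m [set: 'I_n] => // m IH U Um.
have [->|U0] := eqVneq U finset.set0.
  by exists (fun=> 0); split=> [x|x|x]; rewrite ?inE.
have [s sU ss] := chordal_simplicial chH U0.
have cU : #|U| = #|U :\ s|.+1 by rewrite (cardsD1 s U) sU.
have [|r [ri rb rp]] := IH (U :\ s); first by rewrite -ltnS -cU.
exists (fun x => if x == s then #|U :\ s| else r x); split.
- move=> x y xU yU; case: eqVneq => [->|xs]; case: eqVneq => [->//|ys] e.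
  + by have := rb y; rewrite !inE ys yU -e ltnn => /(_ isT).
  + by have := rb x; rewrite !inE xs xU e ltnn => /(_ isT).
  + by apply: ri => //; rewrite !inE ?xs ?ys.
- move=> x xU; rewrite cU; case: eqVneq => // xs.
  by apply: ltnW; rewrite ltnS; apply: rb; rewrite !inE xs.
- move=> x y z xU yU zU yz.
  have [->|xs] := eqVneq x s; first by move=> sy sz _ _; apply: ss.
  have rx : r x < #|U :\ s| by apply: rb; rewrite !inE xs.
  case: eqVneq => [_ _ _|ys]; first by rewrite leqNgt rx.
  case: eqVneq => [_ _ _ _|zs]; first by rewrite leqNgt rx.
  by move=> xy xz; apply: rp => //; rewrite !inE ?xs ?ys ?zs.
Qed.

Definition lower r H v : {set 'I_n} := [set y | adj H v y && (r y < r v)].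

Lemma lowerP r H v y : reflect (adj H v y /\ r y < r v) (y \in lower r H v).
Proof. by rewrite inE; apply: andP. Qed.

Lemma set2_inj_lt r x y x' y' : r y < r x -> r y' < r x' ->
  [set x; y] = [set x'; y'] -> x = x' /\ y = y'.
Proof.
move=> yx yx' e.
have : x \in [set x'; y'] by rewrite -e set21.
have : y \in [set x'; y'] by rewrite -e set22.
have : y' \in [set x; y] by rewrite e set22.
rewrite !inE => /orP[/eqP a|/eqP a] /orP[/eqP b|/eqP b] /orP[/eqP c|/eqP c]; subst => //;
  by move: yx yx'; rewrite ?ltnn // => /ltn_trans h /h; rewrite ltnn.
Qed.

Definition lower_edges r H (S : {set 'I_n}) : {set {set 'I_n}} :=
  [set [set xy.1; xy.2] | xy in [set xy : 'I_n * 'I_n | (xy.1 \in S) && (xy.2 \in lower r H xy.1)]].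

Lemma card_lower_edges r H S : #|lower_edges r H S| = \sum_(v in S) #|lower r H v|.
Proof.
rewrite card_in_imset => [|[x y] [x' y']]; last first.
  rewrite !inE /= => /andP[_ /andP[_ yx]] /andP[_ /andP[_ yx']] e.
  by have [-> ->] := set2_inj_lt yx yx' e.
rewrite -sum1_card (eq_bigl (fun xy => (xy.1 \in S) && (xy.2 \in lower r H xy.1))) => [|xy]; last by rewrite inE.
rewrite -(pair_big_dep (fun x => x \in S) (fun x y => y \in lower r H x) (fun _ _ => 1)) /=.
by apply: eq_bigr => v _; rewrite sum1_card.
Qed.

Lemma lower_edges_sub r H S : lower_edges r H S \subset H.
Proof. by apply/subsetP => e /imsetP[[x y]]; rewrite inE /= => /andP[_ /lowerP[/andP[_ eH] _]] ->. Qed.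

Lemma lower_edgesT r H : injective r -> H \subset pairs n -> lower_edges r H [set: 'I_n] = H.
Proof.
move=> ri Hp; apply/eqP; rewrite eqEsubset lower_edges_sub; apply/subsetP => e eH.
have := subsetP Hp e eH; rewrite inE => /cards2P[x [y [xy exy]]].
wlog yx : x y xy exy / r y < r x.
  move=> W; have [yx|yx|/ri/eqP] := ltngtP (r y) (r x).
  - exact: (W x y).
  - by apply: (W y x); rewrite ?exy 1?eq_sym // finset.setUC.
  - by rewrite eq_sym (negPf xy).
apply/imsetP; exists (x, y) => //; rewrite inE /=; apply/andP; split; first exact: in_setT.
by apply/lowerP; split=> //; rewrite /adj xy -exy.
Qed.

Lemma card_lower_sum r H : injective r -> H \subset pairs n -> #|H| = \sum_v #|lower r H v|.
Proof.
move=> ri Hp; rewrite -{1}(lower_edgesT ri Hp) card_lower_edges.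
by apply: eq_bigl => v; rewrite inE.
Qed.

Definition parent r H v : 'I_n :=
  odflt v [pick u in lower r H v | [forall w in lower r H v, r w <= r u]].

(** The parent is the highest lower neighbour. As the lower neighbours of [v] form a clique, the
    others are adjacent to the parent and ranked below it. *)
Lemma parentP r H v : perfect_rank H r -> injective r -> 0 < #|lower r H v| ->
  parent r H v \in lower r H v /\ lower r H v \subset parent r H v |: lower r H (parent r H v).
Proof.
move=> rp ri /card_gt0P[u0 u0v]; rewrite /parent.
case: pickP => [u /andP[uv /forall_inP umax] /=|none]; last first.
  case: (@arg_maxnP _ u0 (fun u => u \in lower r H v) r u0v) => u uv umax.
  by have := none u; rewrite uv /= => /negbT /negP[]; apply/forall_inP.
split=> //; apply/subsetP => w wv; rewrite in_setU1; have [//|wu] := eqVneq w u.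
have /lowerP[vu ru] := uv; have /lowerP[vw rw] := wv.
apply/lowerP; split; first by apply: (rp v) => //; rewrite 1?eq_sym // ltnW.
by rewrite ltn_neqAle umax // andbT; apply: contra wu => /eqP/ri->.
Qed.

End Elimination.

(** * Counting chordal graphs with bounded lower neighbourhoods *)

Section Counting.
Context {n : nat}.
Implicit Types (H : {set {set 'I_n}}) (v : 'I_n) (r : 'I_n -> nat).
Local Open Scope nat_scope.

(* A lower neighbourhood is its parent [u] together with a subset of the lower
   neighbourhood of [u]; [code] records [u] and the positions of that subset. *)
Definition decodes w (L : 'I_n -> {set 'I_n}) (c : option ('I_n * {set 'I_w})) v : Prop :=
  match c with
  | None => L v = finset.set0
  | Some (u, J) => u \in L v /\ L v =
      u |: [set x in L u | [exists i : 'I_w, (i \in J) && (index x (enum (L u)) == i)]]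
  end.

Lemma decodes_exists w r H v : perfect_rank H r -> injective r ->
  (forall u, #|lower r H u| <= w) -> exists c, decodes (w := w) (lower r H) c v.
Proof.
move=> rp ri lw; have [v0|/set0Pn[u0 u0v]] := eqVneq (lower r H v) finset.set0.
  by exists None.
have [|uv sub] := parentP (v := v) rp ri; first by apply/card_gt0P; exists u0.
set u := parent r H v in uv sub; set L := enum (lower r H u).
exists (Some (u, [set i : 'I_w | [exists x in lower r H v, (x \in lower r H u) && (index x L == i)]])).
split=> //; apply/setP => x; rewrite in_setU1 inE; apply/idP/idP => [xv|/orP[/eqP->//|/andP[xu]]].
  have := subsetP sub x xv; rewrite in_setU1 => /orP[->//|xu]; rewrite xu /=; apply/orP; right.
  have iw : index x L < w.
    by apply: leq_trans (lw u); rewrite cardE index_mem mem_enum.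
  apply/existsP; exists (Ordinal iw); rewrite inE /= eqxx andbT.
  by apply/exists_inP; exists x; rewrite ?xu /=.
move=> /existsP[i]; rewrite inE => /andP[/exists_inP[y yv /andP[yu /eqP yi]] /eqP xi].
have xL : x \in L by rewrite mem_enum.
have yL : y \in L by rewrite mem_enum.
by rewrite -(nth_index u xL) xi -yi nth_index.
Qed.

(** The rankings may differ, yet the code fixes the graph: the vertex [u] in the code of [v] has
    smaller [r1]-rank, so the lower neighbourhoods agree by induction on [r1], and they carry all
    edges. *)
Lemma decodes_inj w r1 r2 H1 H2 (c : 'I_n -> option ('I_n * {set 'I_w})) :
  injective r1 -> injective r2 -> H1 \subset pairs n -> H2 \subset pairs n ->
  (forall v, decodes (lower r1 H1) (c v) v) -> (forall v, decodes (lower r2 H2) (c v) v) ->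
  H1 = H2.
Proof.
move=> ri1 ri2 Hp1 Hp2 d1 d2.
have eqL v : lower r1 H1 v = lower r2 H2 v.
  have [m] := ubnP (r1 v); elim: m v => // m IH v vm.
  have := d2 v; have := d1 v; case: (c v) => [[u S]|] /= => [[uv ->] [_ ->]|-> ->] //.
  rewrite IH //; have /lowerP[_ uv'] := uv.
  by apply: leq_trans uv' _; rewrite -ltnS.
rewrite -(lower_edgesT ri1 Hp1) -(lower_edgesT ri2 Hp2).
have {}eqL : lower r1 H1 = lower r2 H2 by apply/funext.
by rewrite /lower_edges eqL.
Qed.

Definition narrow w H : Prop :=
  H \subset pairs n /\ exists r, [/\ injective r, perfect_rank H r & forall v, #|lower r H v| <= w].

(** Each vertex has at most [n * 2 ^ w + 1] codes: a parent with a set of positions, or [None]. *)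
Lemma card_narrow w : #|[set H | `[< narrow w H >]]| <= (n * 2 ^ w).+1 ^ n.
Proof.
pose rel H (c : {ffun 'I_n -> option ('I_n * {set 'I_w})}) := narrow w H ->
  exists r, injective r /\ forall v, decodes (lower r H) (c v) v.
have [f fP] : exists f, forall H, rel H (f H).
  apply: fin_all_exists => H; have [[Hp [r [ri rp rw]]]|nH] := pselect (narrow w H); last first.
    by exists [ffun=> None].
  have [c cP] : exists c : 'I_n -> option ('I_n * {set 'I_w}), forall v, decodes (lower r H) (c v) v.
    by apply: (@fin_all_exists _ _ (fun v cv => decodes (lower r H) cv v)) => v; exact: decodes_exists.
  by exists [ffun v => c v] => _; exists r; split=> // v; rewrite ffunE.
have cardT : #|{ffun 'I_n -> option ('I_n * {set 'I_w})}| = (n * 2 ^ w).+1 ^ n.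
  by rewrite card_ffun card_option card_prod !card_ord -cardsT -powersetT card_powerset cardsT card_ord.
rewrite -cardT; apply: (@leq_card_in _ _ f) => H1 H2; rewrite !inE => /asboolP n1 /asboolP n2 e.
have [r1 [ri1 d1]] := fP _ n1; have [r2 [ri2 d2]] := fP _ n2.
case: n1 n2 => Hp1 _ [Hp2 _]; apply: (decodes_inj ri1 ri2 Hp1 Hp2 d1).
by rewrite e.
Qed.

End Counting.

(** * Decomposition of a chordal graph into clusters *)

Definition edges_in n (E : {set {set 'I_n}}) (W : {set 'I_n}) : {set {set 'I_n}} :=
  [set e in E | e \subset W].

(** The sets that a cluster beating the ratio [(2 k + 1) / (k + 1)] can occupy together with its
    attachment vertex; [#|W|.-1] is thus the size of the cluster. *)
Definition dense_sets n (E : {set {set 'I_n}}) (k V0 : nat) : {set {set 'I_n}} :=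
  [set W : {set 'I_n} | [&& 1 < #|W| < V0, #|W|.*2 <= #|edges_in E W| + 3 &
            k.*2.+1 * #|W|.-1 < k.+1 * #|edges_in E W|]]%N.

(* Adding the vertices by increasing rank, a vertex with one lower neighbour
   starts a cluster and a vertex with at least two joins the cluster of its
   parent. A cluster with vertex set [S] spans at least [2 #|S| - 1] edges on
   [S] plus one attachment vertex. *)
Section Clusters.
Context {n : nat} {E H : {set {set 'I_n}}} {r : 'I_n -> nat}.
Hypotheses (HE : H \subset E) (ri : injective r) (rp : perfect_rank H r).
Implicit Types (u v w : 'I_n) (S : {set 'I_n}).
Local Open Scope nat_scope.

Let d v := #|lower r H v|.
Let step v := if 1 < d v then parent r H v else v.

Let step_rank v : 1 < d v -> r (step v) < r v.
Proof.
move=> dv; rewrite /step dv; have [|+ _] := parentP (v := v) rp ri; first exact: ltnW.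
by move=> /lowerP[].
Qed.

Let step_rank_le v : r (step v) <= r v.
Proof.
have [/step_rank/ltnW//|dv] := ltnP 1 (d v).
by rewrite /step ltnNge dv.
Qed.

Let step_pos v : 0 < d v -> 0 < d (step v).
Proof.
rewrite /step; case: (ltnP 1 (d v)) => // dv d0.
have [//|_ /subset_leq_card] := parentP (v := v) rp ri.
rewrite -/(d v) cardsU1 => le; have : d v <= 1 + d (parent r H v).
  by apply: leq_trans le _; rewrite leq_add2r leq_b1.
by nlia.
Qed.

Let iter_step_le m v : r v <= m -> d (iter m step v) <= 1.
Proof.
elim: m v => [v|m IH v rv].
  rewrite leqn0 => /eqP rv; rewrite /= /d (_ : lower r H v = finset.set0) ?cards0 //.
  by apply/setP => y; rewrite !inE rv ltn0 andbF.
rewrite iterSr; have [dv|dv] := ltnP 1 (d v).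
  by apply: IH; have := step_rank dv; nlia.
have sv : step v = v by rewrite /step ltnNge dv.
by rewrite sv iter_fix.
Qed.

(** Every proper step lowers the rank, so this many iterations reach a fixed vertex, one with at
    most one lower neighbour. *)
Definition cluster_root v := iter (\max_w r w) step v.
Local Notation root := cluster_root.

Let root_le1 v : d (root v) <= 1.
Proof. by apply: iter_step_le; apply: leq_bigmax. Qed.

Let root_step v : root (step v) = root v.
Proof.
rewrite /root -iterSr iterS -/(root v) {1}/step ltnNge root_le1 //.
Qed.

Let root_id v : d v <= 1 -> root v = v.
Proof. by move=> dv; rewrite /root iter_fix // /step ltnNge dv. Qed.

Let root_pos v : 0 < d v -> d (root v) = 1.
Proof.
move=> dv; apply/eqP; rewrite eqn_leq root_le1 /root.
by elim: (\max_w r w) => //= m; apply: step_pos.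
Qed.

Let root_rank v : r (root v) <= r v.
Proof. by rewrite /root; elim: (\max_w r w) => //= m; apply: leq_trans. Qed.

Definition cluster v := [set w | root w == v].

Section OneCluster.
Variables (v0 q : 'I_n).
Hypothesis low0 : lower r H v0 = [set q].

Let d0 : d v0 = 1. Proof. by rewrite /d low0 cards1. Qed.
Let v0C : v0 \in cluster v0. Proof. by rewrite inE root_id ?d0. Qed.

Let cluster_d v : v \in cluster v0 -> v != v0 -> 1 < d v.
Proof.
rewrite inE => /eqP rv; apply: contraNltn => dv.
by rewrite -rv root_id.
Qed.

Let cluster_rank v : v \in cluster v0 -> r v0 <= r v.
Proof. by rewrite inE => /eqP <-; apply: root_rank. Qed.

Let qC : q \notin cluster v0.
Proof.
apply/negP => /cluster_rank; apply/negP; rewrite -ltnNge.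
by have /lowerP[] : q \in lower r H v0 by rewrite low0 set11.
Qed.

(** The parent of [v] lies in the same cluster and the remaining lower neighbours of [v] are lower
    neighbours of the parent, so induction on rank applies; [q] enters only through the root. *)
Let cluster_lower v : v \in cluster v0 -> lower r H v \subset q |: cluster v0.
Proof.
have [m] := ubnP (r v); elim: m v => // m IH v rm vC.
have [->|/(cluster_d vC) dv] := eqVneq v v0; first by rewrite low0 subsetUl.
have [|uv sub] := parentP (v := v) rp ri; first exact: ltnW.
have uC : parent r H v \in cluster v0.
  by move: vC; rewrite !inE -root_step /step dv.
apply: subset_trans sub _; rewrite subUset sub1set inE uC orbT /=.
by apply: IH => //; have /lowerP[_] := uv; nlia.
Qed.

(** Initial segments of the cluster by rank. They keep the edge count of a cluster and exist in
    every positive size up to that of the cluster, so a large cluster yields a dense set of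
    prescribed size. *)
Definition cluster_prefix S : Prop :=
  [/\ S \subset cluster v0, v0 \in S &
     forall u v, v \in S -> u \in cluster v0 -> r u < r v -> u \in S].

Lemma cluster_prefixT : cluster_prefix (cluster v0).
Proof. by split. Qed.

Let prefix_exists k : 0 < k <= #|cluster v0| -> exists2 S, cluster_prefix S & #|S| = k.
Proof.
move=> /andP[k0 kc]; have [m] := ubnP (#|cluster v0| - k).
elim: m k k0 kc => // m IH k k0 kc km.
have [->|kne] := eqVneq k #|cluster v0|; first by exists (cluster v0).
have [||| S [SC S0 Sp] Sk] := IH k.+1 => //; try nlia.
case: (@arg_maxnP _ v0 (fun v => v \in S) r S0) => u uS umax.
exists (S :\ u); last by move: Sk; rewrite (cardsD1 u S) uS => -[].
split; first exact: subset_trans (subsetDl _ _) SC.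
  rewrite !inE S0 andbT; apply/eqP => uv.
  suff : #|S| <= 1 by nlia.
  rewrite -(cards1 v0); apply/subset_leq_card/subsetP => w wS; rewrite inE; apply/eqP/ri/eqP.
  rewrite eqn_leq cluster_rank ?(subsetP SC) // andbT uv; exact: umax.
move=> a v; rewrite !in_setD1 => /andP[vu vS] aC av; apply/andP; split; last exact: (Sp a v).
by apply: contraTneq av => ->; rewrite -leqNgt; apply: umax.
Qed.

Lemma prefix_sum S : cluster_prefix S -> #|S|.*2 <= (\sum_(v in S) d v).+1.
Proof.
move=> [SC S0 _]; rewrite (big_setD1 v0) //= d0 (cardsD1 v0) S0 doubleS ltnS add1n ltnS.
rewrite -mul2n mulnC -sum_nat_const; apply: leq_sum => v.
by rewrite !inE => /andP[vv0 /(subsetP SC) vC]; apply: cluster_d.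
Qed.

Lemma prefix_edges S : cluster_prefix S -> \sum_(v in S) d v <= #|edges_in E (q |: S)|.
Proof.
move=> [SC S0 Sp]; rewrite -card_lower_edges; apply/subset_leq_card/subsetP => e eL.
rewrite inE (subsetP HE) ?(subsetP (lower_edges_sub _ _ _) _ eL) //=.
move: eL => /imsetP[[x y]]; rewrite inE /= => /andP[xS yx] ->.
rewrite subUset !sub1set !in_setU1 xS orbT /=.
have := subsetP (cluster_lower (subsetP SC _ xS)) y yx; rewrite in_setU1.
case/orP => [->//|yC]; apply/orP; right; apply: (Sp y x) => //.
by have /lowerP[] := yx.
Qed.

Lemma prefix_card S : cluster_prefix S -> #|q |: S| = #|S|.+1.
Proof.
move=> [SC _ _]; rewrite cardsU1 (_ : q \notin S) //.
by apply: contra qC; apply: (subsetP SC).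
Qed.

(** Otherwise a prefix of size [V0 - 1] together with [q] would have [V0] vertices and at least
    [2 (V0 - 1) - 1 = 2 V0 - 3] edges. *)
Lemma cluster_small V0 : 1 < V0 ->
  (forall W : {set 'I_n}, #|W| = V0 -> #|edges_in E W| + 3 < V0.*2) -> #|q |: cluster v0| < V0.
Proof.
move=> V01 nodense; rewrite ltnNge; apply/negP; rewrite prefix_card // => VC.
case: V0 V01 nodense VC => [|[|V]] // _ nodense VC.
have [S Sp Sk] := @prefix_exists V.+1 VC.
have := nodense (q |: S); rewrite prefix_card // Sk.
move=> /(_ erefl); have := prefix_sum Sp; have := prefix_edges Sp; rewrite Sk.
by nlia.
Qed.

Lemma cluster_sum_le : \sum_(v in cluster v0) d v <= #|cluster v0| * #|q |: cluster v0|.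
Proof.
rewrite -sum_nat_const; apply: leq_sum => v vC.
exact: subset_leq_card (cluster_lower vC).
Qed.

End OneCluster.

(** Edges are charged to the cluster of their upper endpoint. An ordinary cluster pays at most
    [(2 k + 1) / (k + 1)] per vertex; an exceptional one has at most [V0 ^ 2] edges, and exceptional
    clusters inject into the dense sets. *)
Lemma perfect_rank_edge_bound k V0 : H \subset pairs n -> 1 < V0 ->
  (forall W : {set 'I_n}, #|W| = V0 -> #|edges_in E W| + 3 < V0.*2) ->
  k.+1 * #|H| <= k.*2.+1 * n + k.+1 * V0 ^ 2 * #|dense_sets E k V0|.
Proof.
move=> Hp V01 nodense.
pose f v := \sum_(w in cluster v) d w.
pose B := [set v | (d v == 1) && (k.*2.+1 * #|cluster v| < k.+1 * f v)].
have sumE : #|H| = \sum_v f v.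
  rewrite (card_lower_sum ri Hp) (partition_big root predT) //=.
  by apply: eq_bigr => v _; apply: eq_bigl => w; rewrite inE.
have sumC : \sum_v #|cluster v| = n.
  transitivity (\sum_(w < n) 1); last by rewrite sum1_card card_ord.
  rewrite [RHS](partition_big root predT) //=.
  by apply: eq_bigr => v _; rewrite -sum1_card; apply: eq_bigl => w; rewrite inE.
have fB v : k.+1 * f v <= k.*2.+1 * #|cluster v| + (v \in B) * (k.+1 * V0 ^ 2).
  rewrite inE; case: (ltnP (k.*2.+1 * #|cluster v|)) => [_|le]; last first.
    by rewrite andbF mul0n addn0.
  have [d1|dv] := eqVneq (d v) 1.
    rewrite mul1n; apply: leq_trans (leq_addl _ _); rewrite leq_mul2l /=.
    have /cards1P[q low] := introT eqP d1.
    apply: leq_trans (cluster_sum_le low) _; rewrite -mulnn leq_mul //.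
      apply: leq_trans (_ : #|q |: cluster v| <= _); first exact: subset_leq_card (subsetUr _ _).
      by apply/ltnW/(cluster_small low).
    by apply/ltnW/(cluster_small low).
  (* A vertex with [d v != 1] is not the root of any vertex having lower neighbours, so its cluster
     carries no edges. *)
  rewrite /f big1 ?muln0 // => w; rewrite inE => /eqP rw.
  by apply/eqP; rewrite -leqn0 leqNgt; apply: contra dv => /root_pos; rewrite rw => ->.
have cardB : #|B| <= #|dense_sets E k V0|.
  pose cover v := lower r H v :|: cluster v.
  have coverP v q : lower r H v = [set q] -> cover v = q |: cluster v.
    by rewrite /cover => ->.
  (* Clusters are disjoint, so equal covers of distinct roots would force [cluster v] into the
     single attachment vertex [q']; a one-vertex cluster has one edge and does not beat the
     ratio. *)
  have coverI : {in B &, injective cover}.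
    move=> v v'; rewrite !inE => /andP[dv Bv] /andP[dv' _] e; apply: contraTeq Bv => vv'.
    have /cards1P[q' low'] := dv'.
    have vC : v \in cluster v by rewrite inE root_id // (eqP dv).
    have sub : cluster v \subset [set q'].
      apply/subsetP => w wC; have : w \in cover v' by rewrite -e inE wC orbT.
      rewrite (coverP _ _ low') in_setU1 in_set1 => /orP[//|].
      by move: wC; rewrite !inE => /eqP ->; rewrite (negPf vv').
    have c1 : cluster v = [set v].
      move: (subset_leq_card sub); rewrite cards1 => c1.
      apply/eqP; rewrite eq_sym eqEcard sub1set vC cards1 //.
    by rewrite /f c1 cards1 big_set1 (eqP dv) -leqNgt; nlia.
  rewrite -(card_in_imset coverI); apply/subset_leq_card/subsetP => W /imsetP[v + ->].
  rewrite inE => /andP[/cards1P[q low] Bv]; rewrite (coverP _ _ low) inE.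
  have pT := cluster_prefixT low.
  have := prefix_edges low pT; have := prefix_sum low pT; rewrite -/(f v).
  have := cluster_small low V01 nodense; rewrite (prefix_card low pT).
  have cpos : 0 < #|cluster v|.
    by apply/card_gt0P; exists v; rewrite inE root_id // /d low cards1.
  move=> h1 h2 h3; apply/and3P; split; first by rewrite ltnS cpos.
    by move: h2 h3; move: (f v) #|cluster v| #|edges_in _ _| => a b c; clear; lia.
  by apply: leq_trans Bv _; rewrite leq_mul2l h3 orbT.
rewrite sumE big_distrr /=.
apply: leq_trans (leq_sum _ (fun v _ => fB v)) _.
rewrite big_split /= -big_distrr /= sumC leq_add2l -big_distrl /= mulnC leq_mul2l.
apply/orP; right; apply: leq_trans cardB.
by rewrite -sum1_card [leqRHS]big_mkcond /=; apply: leq_sum => v _; case: (v \in B).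
Qed.

End Clusters.

(** * The balanced chordal pattern *)

(* The vertices [0, 1, ...] are joined to the [bal_deg j] vertices preceding
   them, where the degrees [bal_deg j] sum to [floor (j A / B)]: every vertex set
   then spans at most [A / B] times one less than its size. *)
Section BalancedGraph.
Variables (A B : nat).
Hypotheses (B0 : (0 < B)%N) (AB : (B.*2 <= A.+1)%N).
Local Open Scope nat_scope.

Definition bal_deg j := (j * A) %/ B - (j.-1 * A) %/ B.

Lemma bal_degS j : bal_deg j.+1 = A %/ B + (B <= (j * A) %% B + A %% B).
Proof. by rewrite /bal_deg mulSn addnC divnD // -addnA addnC addnK. Qed.

Lemma bal_deg_mod j : bal_deg j.+1 * B + (j.+1 * A) %% B = A + (j * A) %% B.
Proof.
have := divn_eq (j.+1 * A) B; have := divn_eq (j * A) B.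
have le : (j * A) %/ B <= (j.+1 * A) %/ B by apply: leq_div2r; rewrite leq_mul2r leqnSn orbT.
rewrite /bal_deg /= mulnBl; move: (leq_mul le (leqnn B)).
by rewrite mulSn; move: (_ %/ B * B) (j.+1 * A %/ B * B) (j * A %% B) (_ %% B) => a b c d; clear; lia.
Qed.

Definition bal_edge i j := (i < j) && (j <= i + bal_deg j).

(** For positive [j] the degree is [A %/ B] or one more, so the lower neighbours of [j] below [i']
    fit into the interval of lower neighbours of [i']. *)
Lemma bal_edge_lower i i' j : bal_edge i j -> bal_edge i' j -> i < i' -> bal_edge i i'.
Proof.
move=> /andP[ij ji] /andP[ij' ji'] ii'; rewrite /bal_edge ii' /=.
case: j ij ji ij' ji' => // j; case: i' ii' => // i'.
rewrite !bal_degS; case: (B <= _ + _); case: (B <= _ + _); clear; lia.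
Qed.

Lemma bal_deg_gt0 j : 0 < bal_deg j.+1.
Proof.
have AgeB : B <= A by clear -B0 AB; lia.
by rewrite bal_degS addn_gt0 divn_gt0 // AgeB.
Qed.

Section Finite.
Variable v : nat.
Implicit Types (S : {set 'I_v}) (i j : 'I_v).

Definition bal_edges S : {set 'I_v * 'I_v} :=
  [set ij | [&& ij.1 \in S, ij.2 \in S & bal_edge ij.1 ij.2]].

Lemma card_ord_itv_le S a b : (forall i, i \in S -> a <= i < b) -> #|S| <= b - a.
Proof.
move=> Sab; rewrite cardE -(size_map val) -(size_iota a (b - a)).
apply: uniq_leq_size; first by rewrite (map_inj_uniq val_inj) enum_uniq.
move=> x /mapP[i]; rewrite mem_enum => /Sab/andP[ai ib] ->.
by rewrite mem_iota subnKC ?ai // ltnW // (leq_ltn_trans ai ib).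
Qed.

Lemma card_ord_itv a b : b <= v -> b - a <= #|[set i : 'I_v | a <= i < b]|.
Proof.
move=> bv; have lt (x : 'I_(b - a)) : a + x < v by have := ltn_ord x; clear -bv; lia.
pose f x := Ordinal (lt x).
have fI : injective f by move=> x y /(congr1 val) /= /addnI/val_inj.
rewrite -[leqLHS]card_ord -(card_imset _ fI); apply/subset_leq_card/subsetP => y /imsetP[x _ ->].
by rewrite inE /=; have := ltn_ord x; clear; lia.
Qed.

Lemma card_bal_edges S t : t \in S -> (forall i, i \in S -> i <= t) ->
  #|bal_edges S| = #|bal_edges (S :\ t)| + #|[set i in S :\ t | bal_edge i t]|.
Proof.
move=> tS tmax; rewrite -(cardsID (setX setT [set t]) (bal_edges S)) addnC; congr (_ + _).
  apply: eq_card => -[i j]; rewrite !inE /=.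
  have [->|jt] := eqVneq j t; first by rewrite andbF.
  have [->|it] := eqVneq i t; last by [].
  rewrite /=; apply/negP => /and3P[_ jS]; rewrite /bal_edge ltnNge tmax //.
have inj : {in [set i in S :\ t | bal_edge i t] &, injective (fun i => (i, t))} by move=> i j _ _ [].
rewrite -(card_in_imset inj); apply: eq_card => -[i j]; rewrite !inE /=.
apply/andP/imsetP => [[/and3P[iS jS e] /eqP jt]|[i']].
  exists i; last by rewrite jt.
  by rewrite !inE iS -jt e !andbT; apply: contraTneq e => ->; rewrite /bal_edge ltnn.
by rewrite !inE => /andP[/andP[_ iS] e] [-> ->]; rewrite iS tS e eqxx.
Qed.

Lemma bal_edges_le1 S : #|S| <= 1 -> bal_edges S = finset.set0.
Proof.
move=> S1; apply/setP => -[i j]; rewrite !inE /=; apply/negP => /and3P[iS jS].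
suff -> : i = j by rewrite /bal_edge ltnn.
by move: S1; rewrite leqNgt; apply: contraNeq => ij; apply/card_gt1P; exists i, j.
Qed.

(** The remainder at the top vertex [t] strengthens the induction. When [t] is removed, either the
    new top is [t - 1] and [bal_deg_mod] balances the remainders, or the gap below [t] costs an
    edge, and the [B] saved exceeds any remainder. *)
Let bal_dense_max S t : 1 < #|S| -> t \in S -> (forall i, i \in S -> i <= t) ->
  B * #|bal_edges S| + (t * A) %% B <= A * #|S|.-1.
Proof.
have [m] := ubnP #|S|; elim: m S t => // m IH S t Sm S1 tS tmax.
have cS : #|S| = #|S :\ t|.+1 by rewrite (cardsD1 t S) tS.
have /card_gt0P[u uS] : 0 < #|S :\ t| by rewrite -ltnS -cS.
case: (@arg_maxnP _ u (fun i => i \in S :\ t) val uS) => t' t'S t'max.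
have t't : t' < t.
  by move: t'S; rewrite !inE => /andP[ne /tmax]; rewrite leq_eqVlt => /orP[/eqP/val_inj e|//]; rewrite e eqxx in ne.
rewrite (card_bal_edges tS tmax) cS /=.
set new := #|[set i in _ | _]|.
have newle : new <= t'.+1 - (t - bal_deg t).
  apply: card_ord_itv_le => i; rewrite inE => /andP[/t'max it' /andP[_ ti]].
  by rewrite ltnS [i <= t']it' andbT leq_subLR addnC.
case et : (t : nat) t't newle => [//|t1] t't newle.
have dmod := bal_deg_mod t1; have dpos := bal_deg_gt0 t1.
(* Two vertices span at most one edge and the remainder is at most [B - 1]; the hypothesis
   [2 B - 1 <= A] closes this case. *)
have [S'1|S'1] := leqP #|S :\ t| 1.
  rewrite (bal_edges_le1 S'1) cards0 add0n (_ : #|S :\ t| = 1); last first.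
    by apply/eqP; rewrite eqn_leq S'1 -ltnS -cS.
  have new1 : new <= 1.
    apply: leq_trans S'1; apply/subset_leq_card/subsetP => i.
    by rewrite inE => /andP[].
  have : t1.+1 * A %% B < B by rewrite ltn_mod.
  have : B * new <= B by rewrite -[leqRHS]muln1 leq_mul2l new1 orbT.
  by move: AB; rewrite muln1; move: (B * new) (_ %% B); clear; lia.
have := IH (S :\ t) t' _ S'1 t'S t'max.
rewrite -ltnS -cS => /(_ Sm).
have [e|ne] := eqVneq (t' : nat) t1.
  rewrite e; have : B * new <= bal_deg t1.+1 * B.
    by rewrite mulnC leq_mul2r; apply/orP; right; move: newle; rewrite e; clear; lia.
  case: #|S :\ t| S'1 => // c _; rewrite /= mulnDr mulnS; move: dmod.
  by move: (B * new) (B * #|_|) (_ * B) (_ %% B) (_ %% B) (A * c); clear; lia.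
have : B * new <= bal_deg t1.+1 * B - B.
  rewrite -[X in _ - X]mul1n -mulnBl [leqLHS]mulnC leq_mul2r; apply/orP; right.
  by move: newle t't ne dpos; clear; lia.
have : t1 * A %% B < B by rewrite ltn_mod.
have : B <= bal_deg t1.+1 * B by rewrite leq_pmull.
case: #|S :\ t| S'1 => // c _; rewrite /= mulnDr mulnS; move: dmod.
by move: (B * new) (B * #|_|) (_ * B) (t' * A %% B) (t1.+1 * A %% B) (_ %% B) (A * c); clear; lia.
Qed.

Lemma bal_dense S : S != finset.set0 -> B * #|bal_edges S| <= A * #|S|.-1.
Proof.
move=> /set0Pn[u uS]; have [S1|S1] := leqP #|S| 1.
  by rewrite (bal_edges_le1 S1) cards0 muln0.
case: (@arg_maxnP _ u (fun i => i \in S) val uS) => t tS tmax.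
by apply: leq_trans (bal_dense_max S1 tS tmax); apply: leq_addr.
Qed.

(** The degrees telescope to [((v - 1) A) %/ B]. Only a vertex [j < bal_deg j] falls short of its
    degree, so the first [D] vertices lose at most [D] edges each. *)
Lemma bal_card_ge : v.-1 * A <= B * #|bal_edges [set: 'I_v]| + B * (A %/ B + 2) ^ 2.
Proof.
set D := (A %/ B).+1.
have degD x : bal_deg x <= D.
  case: x => [|x]; first by rewrite /bal_deg mul0n div0n.
  by rewrite bal_degS /D -addn1 leq_add2l leq_b1.
have sumge : \sum_(j < v) (j - (j - bal_deg j)) <= #|bal_edges [set: 'I_v]|.
  rewrite -sum1_card (eq_bigl (fun ij : 'I_v * 'I_v => true && bal_edge ij.1 ij.2)); last first.
    by move=> ij; rewrite !inE.
  rewrite -(pair_big_dep predT (fun i j : 'I_v => bal_edge i j) (fun _ _ => 1)) /= (exchange_big_dep predT) //=.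
  apply: leq_sum => j _; rewrite sum1_card.
  apply: leq_trans (card_ord_itv (j - bal_deg j) (ltnW (ltn_ord j))) _.
  apply/subset_leq_card/subsetP => i; rewrite !inE /= => /andP[ji ij].
  by rewrite unfold_in /= /bal_edge ij /= addnC -leq_subLR.
have main w : (w.-1 * A) %/ B <= \sum_(j < w) (j - (j - bal_deg j)) + D * minn w D.
  elim: w => [|w IH]; first by rewrite mul0n div0n.
  rewrite big_ord_recr /=.
  have dw : w * A %/ B = w.-1 * A %/ B + bal_deg w.
    by rewrite /bal_deg subnKC // leq_div2r // leq_mul2r leq_pred orbT.
  have dD := degD w.
  have [Dw|wD] := leqP D w.
    have -> : minn w.+1 D = D by apply/minn_idPr; rewrite leqW.
    move: IH; rewrite (minn_idPr Dw) dw.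
    by move: (\sum_(_ < _) _) (bal_deg w) dD Dw (D * D) => a b; move: (_ %/ B); clear; lia.
  have -> : minn w.+1 D = w.+1 by apply/minn_idPl.
  move: IH; rewrite (minn_idPl (ltnW wD)) dw mulnS.
  by move: (\sum_(_ < _) _) (bal_deg w) dD (D * w) => a b; move: (_ %/ B); clear; lia.
have := main v; move: sumge; set M := \sum_(_ < _) _ => sumge mainv.
have -> : (A %/ B + 2) ^ 2 = D ^ 2 + D.*2.+1 by rewrite addn2 -/D -mulnn; clear; lia.
have : v.-1 * A <= B * (v.-1 * A %/ B) + B.
  by rewrite mulnC {1}(divn_eq (A * v.-1) B) mulnC leq_add2l ltnW // ltn_mod.
move=> /leq_trans; apply.
have : B * (v.-1 * A %/ B) <= B * (#|bal_edges [set: 'I_v]| + D ^ 2).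
  rewrite leq_mul2l; apply/orP; right; apply: (leq_trans mainv); apply: leq_add => //.
  by rewrite -mulnn leq_mul2l geq_minr orbT.
rewrite !mulnDr mulnS; move: (B * (_ %/ B)) (B * #|_|) (B * D ^ 2) (B * D.*2); clear; lia.
Qed.

End Finite.
End BalancedGraph.

(** * Packing disjoint copies of a pattern *)

Section Copies.
Context {n v : nat} (F : {set 'I_v * 'I_v}).
Hypothesis Flt : forall i j, (i, j) \in F -> (i < j)%N.
Implicit Types (g : 'I_v -> 'I_n) (i j : 'I_v) (E H : {set {set 'I_n}}) (T : {set 'I_n}).
Local Open Scope nat_scope.

Definition copy g : {set {set 'I_n}} := [set [set g ij.1; g ij.2] | ij in F].

Let ltF ij : ij \in F -> ij.1 < ij.2.
Proof. by case: ij => i j; apply: Flt. Qed.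

Lemma edge_img_inj g ij kl : injective g -> ij \in F -> kl \in F ->
  [set g ij.1; g ij.2] = [set g kl.1; g kl.2] -> ij = kl.
Proof.
move=> gI /ltF + /ltF; case: ij kl => [i j] [k l] /= ij kl e.
have : g i \in [set g k; g l] by rewrite -e set21.
have : g j \in [set g k; g l] by rewrite -e set22.
have : g k \in [set g i; g j] by rewrite e set21.
have : g l \in [set g i; g j] by rewrite e set22.
rewrite !inE !(inj_eq gI) => /orP[/eqP ?|/eqP ?] /orP[/eqP ?|/eqP ?] /orP[/eqP ?|/eqP ?] /orP[/eqP ?|/eqP ?];
  by subst => //; move: ij kl; rewrite ?ltnn // => /ltn_trans h /h; rewrite ltnn.
Qed.

Lemma card_copy g : injective g -> #|copy g| = #|F|.
Proof. by move=> gI; apply: card_in_imset => ij kl; apply: edge_img_inj. Qed.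

Lemma copy_pairs g : injective g -> copy g \subset pairs n.
Proof.
move=> gI; apply/subsetP => e /imsetP[[i j] /Flt ij ->].
by rewrite inE /= cards2 (inj_eq gI) neq_ltn ij.
Qed.

Hypothesis Fclique : forall i i' j, (i, j) \in F -> (i', j) \in F -> i < i' -> (i, i') \in F.

Let adj_copy g x y : injective g -> adj (copy g) (g x) (g y) -> ((x, y) \in F) || ((y, x) \in F).
Proof.
move=> gI /andP[_ /imsetP[[i j] ijF /= e]].
have := ltF ijF => /= ij.
have : g x \in [set g i; g j] by rewrite -e set21.
have : g y \in [set g i; g j] by rewrite -e set22.
have : g i \in [set g x; g y] by rewrite e set21.
have : g j \in [set g x; g y] by rewrite e set22.
rewrite !inE !(inj_eq gI) => /orP[/eqP ?|/eqP ?] /orP[/eqP ?|/eqP ?] /orP[/eqP ?|/eqP ?] /orP[/eqP ?|/eqP ?];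
  by subst; rewrite ?ijF ?orbT //; move: ij; rewrite ltnn.
Qed.

(** Copies are removed until fewer than [t] vertices remain: each exchanges [v] vertices for [#|F|]
    edges, and the last term pays for the leftover. *)
Lemma greedy_copies E t :
  (forall T, t <= #|T| -> exists g, [/\ injective g, (forall i, g i \in T) & copy g \subset E]) ->
  forall T, exists H r, [/\ H \subset E, (forall e, e \in H -> e \subset T),
    perfect_rank H r & #|F| * #|T| <= v * #|H| + #|F| * t].
Proof.
move=> cop T; have [m] := ubnP #|T|; elim: m T => // m IH T Tm.
have [v0|vpos] := posnP v.
  exists finset.set0, (fun=> 0); split=> [|e|x y z _|]; rewrite ?sub0set ?inE //.
    by rewrite /adj inE andbF.
  rewrite cards0 muln0 (_ : F = finset.set0) ?cards0 //.
  by apply/setP => -[[i lt] j]; exfalso; move: lt; rewrite v0.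
have [tT|Tt] := leqP t #|T|; last first.
  exists finset.set0, (fun=> 0); split=> [|e|x y z _|]; rewrite ?sub0set ?inE //.
    by rewrite /adj inE andbF.
  by rewrite cards0 muln0 leq_mul2l ltnW ?orbT.
have [g [gI gT gE]] := cop T tT.
pose W := g @: setT.
have WT : W \subset T by apply/subsetP => x /imsetP[i _ ->].
have cW : #|W| = v by rewrite card_imset // cardsT card_ord.
have cT : #|T| = v + #|T :\: W| by rewrite -(cardsID W T) (setIidPr WT) cW.
have [|H [r [HE HT Hr Hc]]] := IH (T :\: W); first by move: Tm; rewrite cT; clear -vpos; lia.
have copyW e x : e \in copy g -> x \in e -> x \in W.
  by move=> /imsetP[[i j] _ ->]; rewrite !inE => /orP[]/eqP->; apply: imset_f; rewrite inE.
have HW e x : e \in H -> x \in e -> x \notin W.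
  by move=> /HT /subsetP eT /eT; rewrite inE => /andP[].
(* In the new copy the rank is the position in the pattern. Ranks may clash with those outside [W],
   but no edge leaves [W]. The default [0] is never taken, as [x] is in the image of [g]. *)
pose rk x := if x \in W then oapp (@nat_of_ord v) 0 [pick i | g i == x] else r x.
have rkg i : rk (g i) = i.
  rewrite /rk imset_f ?inE //; case: pickP => [j /eqP/gI->//|/(_ i)].
  by rewrite eqxx.
have adjU x y : adj (copy g :|: H) x y = adj (copy g) x y || adj H x y.
  by rewrite /adj inE; case: (x != y).
have adjW x y : adj (copy g :|: H) x y -> (x \in W) = (y \in W) /\ if x \in W then adj (copy g) x y else adj H x y.
  rewrite adjU => /orP[] a; have := a => /andP[_ exy].
    by rewrite !(copyW _ _ exy) ?set21 ?set22.
  by rewrite !(negPf (HW _ _ exy _)) ?set21 ?set22.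
exists (copy g :|: H), rk; split.
- by rewrite subUset gE.
- move=> e; rewrite inE => /orP[eg|/HT/subset_trans]; last by apply; apply: subsetDl.
  by apply/subsetP => x /(copyW _ _ eg)/(subsetP WT).
- move=> x y z yz xy xz.
  have [xyW axy] := adjW _ _ xy; have [xzW axz] := adjW _ _ xz.
  have [xW|xW] := boolP (x \in W); last first.
    rewrite /rk -xyW -xzW (negPf xW) adjU; rewrite (negPf xW) in axy axz.
    by move=> yx zx; rewrite (Hr x) ?orbT.
  rewrite xW in axy axz; move: xyW xzW; rewrite xW => /esym yW /esym zW.
  have /imsetP[a _ ea] := xW; have /imsetP[b _ eb] := yW; have /imsetP[c _ ec] := zW.
  move: axy axz yz; rewrite {}ea {}eb {}ec => /(adj_copy gI) ab /(adj_copy gI) ac.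
  rewrite !rkg (inj_eq gI) adjU => bc ba ca; apply/orP; left.
  have {}ab : (b, a) \in F by case/orP: ab => // /Flt; rewrite ltnNge ba.
  have {}ac : (c, a) \in F by case/orP: ac => // /Flt; rewrite ltnNge ca.
  rewrite /adj (inj_eq gI) bc /=.
  have [lt|lt|/val_inj e] := ltngtP b c.
  + by apply/imsetP; exists (b, c) => //; apply: (Fclique ab ac).
  + by apply/imsetP; exists (c, b); rewrite 1?finset.setUC //; apply: (Fclique ac ab).
  + by rewrite e eqxx in bc.
- rewrite cardsU (_ : copy g :&: H = finset.set0); last first.
    apply/setP => e; rewrite !inE; apply/negP => /andP[eg eH].
    have /imsetP[[i j] _ eij] := eg; have xe : g i \in e by rewrite eij set21.
    by have := HW _ _ eH xe; rewrite (copyW _ _ eg xe).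
  rewrite cards0 subn0 card_copy // cT !mulnDr (mulnC v #|F|) -addnA leq_add2l.
  exact: Hc.
Qed.

Lemma max_chordal_copies E t :
  (forall T, t <= #|T| -> exists g, [/\ injective g, (forall i, g i \in T) & copy g \subset E]) ->
  #|F| * n <= v * max_chordal E + #|F| * t.
Proof.
move=> /greedy_copies /(_ setT) [H [r [HE _ Hr]]]; rewrite cardsT card_ord => /leq_trans; apply.
rewrite leq_add2r leq_mul2l; apply/orP; right; rewrite /max_chordal.
apply: (@leq_bigmax_cond _ _ (fun H => #|H|) H); rewrite HE /=.
by apply/asboolP/(perfect_rank_chordal Hr).
Qed.

End Copies.

(** * The probability that a vertex set contains no copy *)

Definition induced_pairs v (F : {set 'I_v * 'I_v}) (S : {set 'I_v}) : {set 'I_v * 'I_v} :=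
  [set ij in F | (ij.1 \in S) && (ij.2 \in S)].

(* Each vertex [i] of the pattern gets its own pool [g (i, _)] of [s] vertices:
   all functions ['I_v -> 'I_s] then give copies, and two copies share only edges
   inside the set on which the functions agree. *)
Section CopiesProbability.
Context {R : realType} {n v s : nat} (F : {set 'I_v * 'I_v}) (p : R).
Hypothesis Flt : forall i j, (i, j) \in F -> (i < j)%N.
Hypotheses (p0 : 0 < p) (p1 : p <= 1) (s0 : (0 < s)%N).
Variable g : 'I_v * 'I_s -> 'I_n.
Hypothesis gI : injective g.
Implicit Types (f h : {ffun 'I_v -> 'I_s}) (S : {set 'I_v}).

Definition pool_copy f : {set {set 'I_n}} := copy F (fun i => g (i, f i)).
Let place_inj f : injective (fun i => g (i, f i)).
Proof. by move=> i j /gI []. Qed.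

Definition agree f h : {set 'I_v} := [set i | f i == h i].

(** A vertex reveals its pool, hence its position in the pattern; the orientation [i < j] of pattern
    edges rules out swapped endpoints. *)
Let meet_sub f h : pool_copy f :&: pool_copy h \subset
  [set [set g (ij.1, f ij.1); g (ij.2, f ij.2)] | ij in induced_pairs F (agree f h)].
Proof.
apply/subsetP => e; rewrite inE => /andP[/imsetP[[i j] ijF /= ->] /imsetP[[k l] klF /= e2]].
have ij := Flt ijF; have kl := Flt klF.
have : g (i, f i) \in [set g (k, h k); g (l, h l)] by rewrite -e2 set21.
have : g (j, f j) \in [set g (k, h k); g (l, h l)] by rewrite -e2 set22.
rewrite !inE !(inj_eq gI) => Hj Hi.
suff [fi fj] : f i = h i /\ f j = h j.
  by apply/imsetP; exists (i, j) => //; rewrite !inE ijF /= fi fj !eqxx.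
case/orP: Hj => /eqP [ej fj]; case/orP: Hi => /eqP [ei fi]; subst => //;
  by [move: ij; rewrite ltnn | move: (ltn_trans ij kl); rewrite ltnn].
Qed.

Let card_meet f h : (#|pool_copy f :&: pool_copy h| <= #|induced_pairs F (agree f h)|)%N.
Proof. by apply: leq_trans (subset_leq_card (meet_sub f h)) (leq_imset_card _ _). Qed.

Let meet_agree f h : pool_copy f :&: pool_copy h != finset.set0 -> (1 < #|agree f h|)%N.
Proof.
move=> /set0Pn[e /(subsetP (meet_sub f h)) /imsetP[[i j]]].
rewrite !inE => /and3P[/= ijF fi fj] _; apply/card_gt1P; exists i, j; rewrite !inE fi fj.
by split=> //; rewrite neq_ltn Flt.
Qed.

Let card_agree f S : (#|[set h | agree f h == S]| <= s ^ (v - #|S|))%N.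
Proof.
pose Q i : pred 'I_s := if i \in S then pred1 (f i) else predT.
have sub : [set h | agree f h == S] \subset family Q.
  apply/subsetP => h; rewrite inE => /eqP eS; apply/familyP => i; rewrite /Q -eS inE.
  by case: eqP => [->|_]; rewrite inE.
apply: leq_trans (subset_leq_card sub) _.
rewrite card_family foldrE big_map big_enum /= (bigID (mem S)) /=.
rewrite big1 => [|i iS]; last by rewrite /Q iS card1.
rewrite mul1n (eq_bigr (fun=> s)) => [|i /negPf iS]; last by rewrite /Q iS card_ord.
rewrite prod_nat_const leq_eqVlt; apply/orP; left; apply/eqP; congr (_ ^ _)%N.
have /(congr1 (fun x => (x - #|S|)%N)) := cardC (mem S).
by rewrite card_ord addKn => <-; apply: eq_card.
Qed.

(** Janson's inequality with [q = c / mu], where [mu] is the expected number of copies, so that the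
    linear term is [c]. Pairs of copies are grouped by the set [S] of agreement, which has at least
    two elements once an edge is shared; each [S] contributes the inverse of the expected count of
    the subpattern on [S]. *)
Lemma pool_copies_avoided (c : R) : 0 <= c <= s%:R ^+ v * p ^+ #|F| ->
  Pr (pairs n) p (fun E => [forall f : {ffun 'I_v -> 'I_s}, ~~ (pool_copy f \subset E)]) <=
  expR (- (c - c ^+ 2 * \sum_(S : {set 'I_v} | (1 < #|S|)%N)
     (s%:R ^+ #|S| * p ^+ #|induced_pairs F S|)^-1)).
Proof.
move=> /andP[c0 cmu]; set mu := s%:R ^+ v * _ in cmu.
have sR : 0 < s%:R :> R by rewrite ltr0n.
have mu0 : 0 < mu by rewrite mulr_gt0 ?exprn_gt0.
have q01 : 0 <= c / mu <= 1 by rewrite divr_ge0 ?(ltW mu0) // ler_pdivrMr // mul1r.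
have p01 : 0 <= p <= 1 by rewrite ltW.
have := janson p01 (fun f => copy_pairs Flt (@place_inj f)) q01.
move=> /le_trans; apply; rewrite ler_expR lerN2.
have -> : \sum_(f : {ffun 'I_v -> 'I_s}) p ^+ #|copy F (fun i => g (i, f i))| = mu.
  rewrite (eq_bigr (fun=> p ^+ #|F|)) => [|f _]; last by rewrite (card_copy Flt).
  by rewrite sumr_const card_ffun !card_ord /mu -natrX mulr_natl.
rewrite -(mulrA c) mulVf ?gt_eqF // mulr1 lerD2l lerN2.
rewrite expr_div_n -mulrA ler_wpM2l ?exprn_ge0 // ler_pdivrMl ?exprn_gt0 //.
set X := \sum_(S : {set 'I_v} | _) _.
have -> : mu ^+ 2 * X = \sum_(f : {ffun 'I_v -> 'I_s}) p ^+ #|F| * mu * X.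
  rewrite sumr_const card_ffun !card_ord -mulr_natl natrX expr2 {1}/mu; ring.
apply: ler_sum => f _.
apply: (@le_trans _ _ (\sum_(h | (1 < #|agree f h|)%N) p ^+ (#|F| + #|F| - #|induced_pairs F (agree f h)|))).
  rewrite [leLHS]big_mkcond [leRHS]big_mkcond; apply: ler_sum => h _.
  case: ifP => [/andP[_ /meet_agree ->]|_]; last by case: ifP => // _; rewrite exprn_ge0 // ltW.
  apply: ler_wiXn2l => //; first exact: ltW.
  by rewrite cardsU !(card_copy Flt) //; apply: leq_sub2l; apply: card_meet.
rewrite (partition_big (agree f) (fun S => (1 < #|S|)%N)) //= mulr_sumr.
apply: ler_sum => S S1.
rewrite (eq_bigr (fun=> p ^+ (#|F| + #|F| - #|induced_pairs F S|))) => [|h /andP[_ /eqP->]//].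
rewrite sumr_const -[leLHS]mulr_natl.
apply: (@le_trans _ _ ((s ^ (v - #|S|))%:R * p ^+ (#|F| + #|F| - #|induced_pairs F S|))).
  apply: ler_wpM2r; first by rewrite exprn_ge0 // ltW.
  rewrite ler_nat; apply: leq_trans (card_agree f S).
  by apply/subset_leq_card/subsetP => h; rewrite inE => /andP[_].
have le1 : (#|S| <= v)%N by rewrite -[leqRHS]card_ord max_card.
have le2 : (#|induced_pairs F S| <= #|F|)%N.
  by apply/subset_leq_card/subsetP => ij; rewrite inE => /andP[].
rewrite natrX exprB // ?unitfE ?gt_eqF // exprB ?unitfE ?gt_eqF // ?(leq_trans le2) ?leq_addr //.
rewrite invfM exprD /mu le_eqVlt; apply/orP; left; apply/eqP; ring.
Qed.

End CopiesProbability.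

(** The factor [2 ^+ n] is the union bound over vertex sets [T]; [v * s <= t] makes room in [T] for
    [v] disjoint pools. *)
Lemma max_chordal_janson (R : realType) (n v s t : nat) (F : {set 'I_v * 'I_v}) (p c : R) :
  (forall i j, (i, j) \in F -> (i < j)%N) ->
  (forall i i' j, (i, j) \in F -> (i', j) \in F -> (i < i')%N -> (i, i') \in F) ->
  0 < p -> p <= 1 -> (0 < s)%N -> (v * s <= t)%N ->
  0 <= c <= s%:R ^+ v * p ^+ #|F| ->
  Pr (pairs n) p (fun E => (v * max_chordal E + #|F| * t < #|F| * n)%N) <=
  2 ^+ n * expR (- (c - c ^+ 2 * \sum_(S : {set 'I_v} | (1 < #|S|)%N)
     (s%:R ^+ #|S| * p ^+ #|induced_pairs F S|)^-1)).
Proof.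
move=> Flt Fcl p0 p1 s0 vst cmu.
have p01 : 0 <= p <= 1 by rewrite ltW.
pose bad (T : {set 'I_n}) (E : {set {set 'I_n}}) := ~~ `[< exists g : 'I_v -> 'I_n,
  [/\ injective g, (forall i, g i \in T) & copy F g \subset E] >].
apply: (@le_trans _ _ (Pr (pairs n) p (fun E => [exists T : {set 'I_n}, (t <= #|T|)%N && bad T E]))).
  apply: le_Pr => // E _; rewrite ltnNge; apply: contraNT => /existsPn H.
  apply: max_chordal_copies => // T tT; have := H T; rewrite tT /= negbK.
  by move/asboolP.
apply: le_trans (Pr_exists_le _ _ _ p01) _.
set X := expR _.
apply: (@le_trans _ _ (\sum_(T : {set 'I_n}) X)); last first.
  by rewrite sumr_const -[leLHS]mulr_natl -cardsT -powersetT card_powerset cardsT card_ord natrX.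
rewrite big_mkcond; apply: ler_sum => T _; case: ifP => [tT|_]; last exact: expR_ge0.
have le : (#|{: 'I_v * 'I_s}| <= #|T|)%N by rewrite card_prod !card_ord (leq_trans vst).
pose g x := enum_val (widen_ord le (enum_rank x)).
have gI : injective g.
  by move=> x y /enum_val_inj/(congr1 val)/= /val_inj/enum_rank_inj.
apply: le_trans (pool_copies_avoided Flt p0 p1 s0 gI cmu).
apply: le_Pr => // E _ /asboolP bE; apply/forallP => f; apply/negP => fE; apply: bE.
exists (fun i => g (i, f i)); split=> // [i j /gI []//|i].
exact: enum_valP.
Qed.

(** * First-moment bounds at fixed [n] *)

Section UpperBounds.
Context {R : realType} {n : nat}.
Variable p : R.
Hypothesis p01 : 0 <= p <= 1.
Implicit Types (E H : {set {set 'I_n}}) (W : {set 'I_n}).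

Let p0 : 0 <= p. Proof. by case/andP: p01. Qed.

Lemma max_chordal_attained E : exists H, [/\ H \subset E, chordal H & max_chordal E = #|H|].
Proof.
rewrite /max_chordal.
have [|H] := @eq_bigmax_cond _ (fun H => (H \subset E) && `[< chordal H >]) (fun H => #|H|).
  apply/card_gt0P; exists finset.set0; rewrite unfold_in sub0set /=; apply/asboolP.
  by apply: (@perfect_rank_chordal _ _ (fun=> 0%N)) => x y z _; rewrite /adj inE andbF.
by rewrite unfold_in => /andP[HE /asboolP cH] ->; exists H.
Qed.

Lemma exists_subset_card (T : finType) (A : {set T}) m : (m <= #|A|)%N ->
  exists2 B : {set T}, B \subset A & #|B| = m.
Proof.
rewrite -bin_gt0 -cards_draws => /card_gt0P[B]; rewrite inE => /andP[BA /eqP Bm].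
by exists B.
Qed.

Lemma card_vertex_sets s : (#|[set W : {set 'I_n} | #|W| == s]| <= n ^ s)%N.
Proof.
rewrite card_draws card_ord; apply: (@leq_trans (n ^_ s)%N).
  by rewrite -bin_ffact leq_pmulr // fact_gt0.
by elim: s => // s IH; rewrite ffactnSr expnSr leq_mul // leq_subr.
Qed.

Definition pairs_in W : {set {set 'I_n}} := [set e : {set 'I_n} | e \subset W & #|e| == 2%N].

Lemma card_pairs_in W : #|pairs_in W| = 'C(#|W|, 2).
Proof. exact: cards_draws. Qed.

Lemma pairs_in_pairs W : pairs_in W \subset pairs n.
Proof. by apply/subsetP => e; rewrite !inE => /andP[]. Qed.

Lemma Pr_edges_in_ge W m :
  Pr (pairs n) p (fun E => (m <= #|edges_in E W|)%N) <= 2 ^+ 'C(#|W|, 2) * p ^+ m.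
Proof.
pose Q (A : {set {set 'I_n}}) := (A \subset pairs_in W) && (#|A| == m).
apply: (@le_trans _ _ (Pr (pairs n) p (fun E => [exists A, Q A && (A \subset E)]))).
  apply: le_Pr => // E Ep /exists_subset_card[A /subsetP AE Am].
  apply/existsP; exists A; rewrite /Q Am eqxx andbT; apply/andP; split.
    apply/subsetP => e eA; have := AE e eA; rewrite !inE => /andP[/(subsetP Ep)].
    by rewrite inE => -> ->.
  by apply/subsetP => e /AE; rewrite inE => /andP[].
apply: le_trans (Pr_exists_le _ _ _ p01) _.
rewrite (eq_bigr (fun=> p ^+ m)) => [|A /andP[AW /eqP Am]]; last first.
  by rewrite Pr_supset ?Am // (subset_trans AW) // pairs_in_pairs.
rewrite sumr_const -[leLHS]mulr_natl ler_wpM2r ?exprn_ge0 // -natrX ler_nat.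
rewrite -card_pairs_in -card_powerset; apply/subset_leq_card/subsetP => A.
by rewrite unfold_in inE => /andP[].
Qed.

Lemma sum_vertex_sets_le s (x : R) : 0 <= x ->
  \sum_(W : {set 'I_n} | #|W| == s) x <= n%:R ^+ s * x.
Proof.
move=> x0; rewrite sumr_const -[leLHS]mulr_natl ler_wpM2r // -natrX ler_nat.
apply: leq_trans (card_vertex_sets s).
by apply/subset_leq_card/subsetP => A; rewrite unfold_in inE.
Qed.

Lemma Pr_exists_edges_in_ge s m :
  Pr (pairs n) p (fun E => [exists W : {set 'I_n}, (#|W| == s) && (m <= #|edges_in E W|)%N]) <=
  n%:R ^+ s * (2 ^+ 'C(s, 2) * p ^+ m).
Proof.
apply: le_trans (Pr_exists_le _ _ _ p01) _.
apply: le_trans (sum_vertex_sets_le s _); last by rewrite mulr_ge0 ?exprn_ge0.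
by apply: ler_sum => W /eqP Ws; have := Pr_edges_in_ge W m; rewrite Ws.
Qed.

(** A lower neighbourhood with more than [w] vertices contains a clique on [w + 1] vertices.
    Otherwise the optimal subgraph is narrow, and the union bound runs over narrow graphs only. *)
Lemma Pr_max_chordal_ge w m :
  Pr (pairs n) p (fun E => (m <= max_chordal E)%N) <=
  n%:R ^+ w.+1 * p ^+ 'C(w.+1, 2) + (n * 2 ^ w).+1%:R ^+ n * p ^+ m.
Proof.
pose clique E := [exists W : {set 'I_n}, (#|W| == w.+1) && (pairs_in W \subset E)].
pose big E := [exists H : {set {set 'I_n}}, ((H \in [set H | `[< narrow w H >]]) && (m <= #|H|)%N) && (H \subset E)].
apply: (@le_trans _ _ (Pr (pairs n) p (fun E => clique E || big E))).
  apply: le_Pr => // E Ep mE; apply/orP.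
  have [H [HE cH eH]] := max_chordal_attained E.
  have [r ri rp] := chordal_perfect_rank cH.
  have [[v lv]|nv] := pselect (exists v, (w < #|lower r H v|)%N); [left|right].
    have [W /subsetP Wv Wc] := exists_subset_card lv.
    apply/existsP; exists W; rewrite Wc eqxx /=; apply/subsetP => e.
    rewrite !inE => /andP[eW /cards2P[x [y [xy exy]]]]; subst e.
    move: eW; rewrite subUset !sub1set => /andP[/Wv/lowerP[vx rx] /Wv/lowerP[vy ry]].
    have /andP[_] : adj H x y by apply: (rp v) => //; apply: ltnW.
    exact: (subsetP HE).
  apply/existsP; exists H; rewrite HE -eH mE !andbT inE; apply/asboolP; split.
    exact: subset_trans Ep.
  exists r; split=> // v; rewrite leqNgt; apply/negP => lv; apply: nv; by exists v.
apply: le_trans (PrU_le _ _ _ p01) _; apply: lerD.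
  apply: le_trans (Pr_exists_le _ _ _ p01) _.
  apply: le_trans (sum_vertex_sets_le w.+1 _); last exact: exprn_ge0.
  by apply: ler_sum => W /eqP Ws; rewrite Pr_supset ?pairs_in_pairs // card_pairs_in Ws.
apply: le_trans (Pr_exists_le _ _ _ p01) _.
apply: (@le_trans _ _ (\sum_(H in [set H : {set {set 'I_n}} | `[< narrow w H >]]) p ^+ m)).
  rewrite big_mkcondr; apply: ler_sum => H; rewrite inE => /asboolP[Hp _].
  case: ifP => [mH|_]; last exact: exprn_ge0.
  rewrite Pr_supset //; apply: ler_wiXn2l => //; by case/andP: p01.
rewrite sumr_const -[leLHS]mulr_natl ler_wpM2r ?exprn_ge0 // -natrX ler_nat.
exact: card_narrow.
Qed.

(** For [s - 1 <= k + 1], having [2 (s - 1) - 1] edges does not exceed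
    [(2 k + 1) (s - 1) / (k + 1)], so a dense set on [s] vertices has an edge more than the generic
    [2 s - 3]. *)
Definition dense_edges k s := if (s <= k.+2)%N then s.*2.-2 else (s.*2 - 3)%N.

Lemma dense_edges_le E k V0 W : W \in dense_sets E k V0 -> (dense_edges k #|W| <= #|edges_in E W|)%N.
Proof.
rewrite inE => /and3P[/andP[W1 _] h2 h3]; rewrite /dense_edges; case: ifP => Wk; last by nlia.
move: W1 h2 h3 Wk; move: #|W| #|edges_in E W| => s e; clear.
case: s => [|s] //= _ h2 h3 Wk; rewrite leqNgt; apply/negP => es.
suff : (k.+1 * e <= k.*2.+1 * s)%N by rewrite leqNgt h3.
have : (k.+1 * e.+1 <= k.+1 * s.*2)%N by rewrite leq_mul2l; apply/orP; right; move: es; clear; lia.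
rewrite -!muln2; move: Wk; clear; nia.
Qed.

(** The first term excludes dense sets of size [V0], which caps the clusters; the second is Markov's
    inequality for having at least [x] smaller dense sets. *)
Lemma Pr_max_chordal_dense k V0 (x : R) : (1 < V0)%N -> 0 < x ->
  Pr (pairs n) p (fun E => k.*2.+1%:R * n%:R + k.+1%:R * V0%:R ^+ 2 * x < k.+1%:R * (max_chordal E)%:R) <=
  n%:R ^+ V0 * (2 ^+ 'C(V0, 2) * p ^+ (V0.*2 - 3)) +
  x^-1 * \sum_(s < V0 | (1 < s)%N) n%:R ^+ s * (2 ^+ 'C(s, 2) * p ^+ dense_edges k s).
Proof.
move=> V01 x0.
pose dense E := [exists W : {set 'I_n}, (#|W| == V0) && (V0.*2 - 3 <= #|edges_in E W|)%N].
apply: (@le_trans _ _ (Pr (pairs n) p (fun E => dense E || (x <= #|dense_sets E k V0|%:R)))).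
  apply: le_Pr => // E Ep; apply: contraTT; rewrite negb_or -ltNge -leNgt => /andP[/existsPn nd dx].
  have [H [HE cH ->]] := max_chordal_attained E.
  have [r ri rp] := chordal_perfect_rank cH.
  have nodense (W : {set 'I_n}) : #|W| = V0 -> (#|edges_in E W| + 3 < V0.*2)%N.
    by move=> WV; have := nd W; rewrite WV eqxx /= -ltnNge ltn_subRL addnC.
  have le := perfect_rank_edge_bound HE ri rp k (subset_trans HE Ep) V01 nodense.
  rewrite -natrM; apply: (@le_trans _ _ (k.*2.+1 * n + k.+1 * V0 ^ 2 * #|dense_sets E k V0|)%:R).
    by rewrite ler_nat.
  by rewrite natrD !natrM expr2 lerD2l ler_wpM2l ?mulr_ge0 // ltW.
apply: le_trans (PrU_le _ _ _ p01) _; apply: lerD; first exact: Pr_exists_edges_in_ge.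
apply: le_trans (markov_Ex _ p01 x0 _) _ => //.
rewrite ler_wpM2l ?invr_ge0 ?(ltW x0) //.
pose D E := \sum_(s < V0 | (1 < s)%N) \sum_(W : {set 'I_n} | #|W| == s) (dense_edges k s <= #|edges_in E W|)%N%:R : R.
apply: (@le_trans _ _ (Ex (pairs n) p D)).
  apply: le_Ex => // E Ep; rewrite -sum1_card natr_sum /D.
  rewrite [leRHS](exchange_big_dep predT) //= [leLHS]big_mkcond; apply: ler_sum => W _.
  case: ifP => [Wd|_]; last by apply: sumr_ge0.
  have := Wd; rewrite inE => /and3P[/andP[W1 W2] _ _].
  rewrite (bigD1 (Ordinal W2)) /=; last by rewrite W1 eqxx.
  by rewrite (dense_edges_le Wd) //= lerDl; apply: sumr_ge0.
rewrite /D Ex_sum; apply: ler_sum => s _; rewrite Ex_sum.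
apply: le_trans (sum_vertex_sets_le s _); last by rewrite mulr_ge0 ?exprn_ge0.
by apply: ler_sum => W /eqP Ws; have := Pr_edges_in_ge W (dense_edges k s); rewrite Ws.
Qed.

End UpperBounds.

(** * Exponents of [n], and the lower tail *)

Section Asymptotics.
Context {R : realType}.
Implicit Types (a b d x y : R).

Lemma gnp_probE n (p : R) (P : pred {set {set 'I_n}}) : gnp_prob p P = Pr (pairs n) p P.
Proof.
rewrite /gnp_prob /Pr /Ex big_mkcondr; apply: eq_bigr => E _.
by case: (P E); rewrite ?mulr1 ?mulr0.
Qed.

Lemma near_powR_le d x : 0 < d -> 0 < x -> \forall n \near eventually, n%:R `^ (- d) <= x.
Proof.
move=> d0 x0; have := nbhs_infty_ger (x `^ (- d^-1)); apply: filterS => n xn.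
have n0 : 0 < n%:R :> R by apply: lt_le_trans xn; apply: powR_gt0.
have -> : x = (x `^ (- d^-1)) `^ (- d).
  by rewrite -powRrM mulrNN mulVf ?gt_eqF // powRr1 // ltW.
rewrite powRN [leRHS]powRN lef_pV2 ?posrE ?powR_gt0 //.
by apply: ge0_ler_powR => //; rewrite ?nnegrE ?powR_ge0 // ltW.
Qed.

Section PowerBounds.
Variables (n : nat) (p : R).
Hypothesis n1 : (0 < n)%N.
Let N1 : 1 <= n%:R :> R. Proof. by rewrite ler1n. Qed.
Let N0 : 0 < n%:R :> R. Proof. by rewrite ltr0n. Qed.

Lemma powR_expM x s m : n%:R ^+ s * (n%:R `^ x) ^+ m = n%:R `^ (s%:R + x * m%:R) :> R.
Proof.
rewrite -powR_mulrn ?ler0n // -powR_mulrn ?powR_ge0 // -powRrM powRD //.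
by apply/implyP => _; rewrite gt_eqF.
Qed.

Lemma powR_le_exp a s m y : 0 <= p <= n%:R `^ (- a) -> s%:R - a * m%:R <= y ->
  n%:R ^+ s * p ^+ m <= n%:R `^ y.
Proof.
move=> /andP[p0 pa] le; apply: (@le_trans _ _ (n%:R `^ (s%:R - a * m%:R))); last exact: ler_powR.
rewrite -mulNr -powR_expM ler_wpM2l ?exprn_ge0 //.
by rewrite lerXn2r // nnegrE ?powR_ge0.
Qed.

Lemma exp_le_powR b s m y : n%:R `^ (- b) <= p -> y <= s%:R - b * m%:R ->
  n%:R `^ y <= n%:R ^+ s * p ^+ m.
Proof.
move=> pb le; apply: (@le_trans _ _ (n%:R `^ (s%:R - b * m%:R))); first exact: ler_powR.
rewrite -mulNr -powR_expM ler_wpM2l ?exprn_ge0 //.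
by rewrite lerXn2r // nnegrE ?powR_ge0 // (le_trans (powR_ge0 _ _) pb).
Qed.

End PowerBounds.

Lemma exponent_near p alpha a b : exponent_is p alpha -> a < alpha < b ->
  \forall n \near eventually, n%:R `^ (- b) <= p n <= n%:R `^ (- a).
Proof.
move=> [e [e0 pE]] /andP[aa ab].
have dpos : 0 < Num.min (alpha - a) (b - alpha) by rewrite lt_min !subr_gt0 aa.
have /cvgr0Pnorm_le := e0 => /(_ _ dpos).
have := nbhs_infty_ger (2 : R); apply: filterS2 => n n2.
rewrite le_min => /andP[ea eb]; move: n2; rewrite ler_nat => n2; rewrite pE //.
have n1 : 1 <= n%:R :> R by rewrite ler1n; lia.
move: ea eb; rewrite !ler_norml => /andP[_ ea] /andP[eb _].
by apply/andP; split; apply: ler_powR => //; lra.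
Qed.

Section Lower.
Variables (A B : nat).
Hypotheses (B0 : (0 < B)%N) (AB : (B.*2 <= A.+1)%N).

Let ratio_bal v m : (v.-1 * A <= B * m + B * (A %/ B + 2) ^ 2)%N -> (0 < v)%N ->
  A%:R / B%:R - (A + B * (A %/ B + 2) ^ 2)%:R / (B%:R * v%:R) <= m%:R / v%:R :> R.
Proof.
move=> le v0; set K := (_ ^ 2)%N in le *.
have BR : 0 < B%:R :> R by rewrite ltr0n.
have vR : 0 < v%:R :> R by rewrite ltr0n.
have h : (A%:R * v%:R - (A + B * K)%:R <= B%:R * m%:R :> R).
  rewrite lerBlDr -!natrM -natrD ler_nat.
  case: v le v0 vR => // v; rewrite /= => le _ _; move: le.
  by rewrite mulnS (mulnC v); move: (A * v)%N (B * m)%N (B * K)%N; clear; lia.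
rewrite ler_pdivlMr // mulrBl invfM.
have -> : A%:R / B%:R * v%:R - (A + B * K)%:R * (B%:R^-1 / v%:R) * v%:R =
   (A%:R * v%:R - (A + B * K)%:R) / B%:R :> R by field; rewrite !gt_eqF.
by rewrite ler_pdivrMr // [leRHS]mulrC.
Qed.

(** Relative to [A / B], a large fixed pattern loses at most [eps / 2] in density, and pools of size
    [n / q] leave vertices uncovered at a cost of at most [eps / 4]. *)
Lemma lower_tail (p : nat -> R) alpha eps eta : 0 < alpha ->
  (forall n, 0 <= p n <= 1) -> exponent_is p alpha -> alpha * A%:R < B%:R ->
  0 < eps -> 0 < eta ->
  \forall n \near eventually,
    Pr (pairs n) (p n) (fun E => Xn_over_n R E < A%:R / B%:R - eps) <= eta.
Proof.
move=> alpha0 p01 pexp aAB eps0 eta0.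
have BR : 0 < B%:R :> R by rewrite ltr0n.
have AR : 0 < A%:R :> R by rewrite ltr0n; move: AB B0; clear; lia.
have [b ab bAB] : exists2 b, alpha < b & b * A%:R < B%:R.
  exists ((alpha + B%:R / A%:R) / 2).
    by rewrite midf_lt // ltr_pdivlMr.
  by rewrite -ltr_pdivlMr // midf_lt // ltr_pdivlMr.
set d := 1 - b * A%:R / B%:R.
have d0 : 0 < d by rewrite subr_gt0 ltr_pdivrMr // mul1r.
set K := (A + B * (A %/ B + 2) ^ 2)%N.
have [v [v2 vK]] : exists v, (1 < v)%N /\ K%:R / (B%:R * v%:R) <= eps / 2.
  have [m _ mP] := nbhs_infty_ger (2 * K%:R / (B%:R * eps)).
  exists (maxn m 2); split; first by rewrite leq_max orbT.
  have vR : 0 < (maxn m 2)%:R :> R by rewrite ltr0n leq_max orbT.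
  have := mP (maxn m 2) (leq_maxl _ _) => /=.
  rewrite !ler_pdivrMr ?mulr_gt0 // => h.
  rewrite (le_trans _ (_ : (maxn m 2)%:R * (B%:R * eps) / 2 <= _)) //; first lra.
  by rewrite le_eqVlt; apply/orP; left; apply/eqP; field.
have v0 : (0 < v)%N by apply: ltnW.
have vR : 0 < v%:R :> R by rewrite ltr0n.
have [q [q0 qP]] : exists q, (0 < q)%N /\ A%:R / B%:R * (v%:R / q%:R) <= eps / 4.
  have [m _ mP] := nbhs_infty_ger (4 * A%:R * v%:R / (B%:R * eps)).
  exists (maxn m 1); split; first by rewrite leq_max orbT.
  have qR : 0 < (maxn m 1)%:R :> R by rewrite ltr0n leq_max orbT.
  have := mP (maxn m 1) (leq_maxl _ _) => /=.
  rewrite ler_pdivrMr ?mulr_gt0 // mulrA ler_pdivrMr // => h.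
  rewrite (_ : A%:R / B%:R * v%:R = 4 * A%:R * v%:R / B%:R / 4 :> R); last by field; rewrite gt_eqF.
  rewrite (_ : eps / 4 * _ = (maxn m 1)%:R * (B%:R * eps) / B%:R / 4); last by field; rewrite gt_eqF.
  by rewrite !ler_pM2r ?invr_gt0.
pose F : {set 'I_v * 'I_v} := bal_edges A B setT.
pose kap : R := (2 * q%:R)^-1.
have qR : 0 < q%:R :> R by rewrite ltr0n.
have kap0 : 0 < kap by rewrite invr_gt0 mulr_gt0.
have kap1 : kap <= 1.
  by rewrite /kap invf_le1 ?mulr_gt0 // -natrM ler1n muln_gt0 q0.
(* The [9] is the square of the [3] in [c = 3 n], and [2 ^+ v] counts the sets [S]: [n ^ d >= C]
   makes the pair term of Janson's inequality at most [n]. *)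
pose C : R := 9 * 2 ^+ v / kap ^+ v.
have C0 : 0 < C by rewrite /C divr_gt0 ?exprn_gt0 // mulr_gt0 ?exprn_gt0.
near=> n.
have n0 : (0 < n)%N by near: n; exists 1%N.
have NR : 0 < n%:R :> R by rewrite ltr0n.
have pn : n%:R `^ (- b) <= p n.
  near: n; have := exponent_near pexp (_ : alpha - 1 < alpha < b).
  rewrite ab andbT gtrDl ltrN10 => /(_ isT); by apply: filterS => n /andP[].
have p0 : 0 < p n by apply: lt_le_trans pn; apply: powR_gt0.
have p1 : p n <= 1 by case/andP: (p01 n).
have small : n%:R `^ (- d) <= C^-1 by near: n; apply: near_powR_le => //; rewrite invr_gt0.
have q2n : (q.*2 <= n)%N by near: n; exists q.*2.
pose s := (n %/ q)%N.
have s0 : (0 < s)%N by rewrite divn_gt0 // (leq_trans _ q2n) // -addnn leq_addr.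
have sqn : (s * q <= n)%N by exact: leq_trunc_div.
have sk : kap * n%:R <= s%:R.
  rewrite /kap mulrC ler_pdivrMr ?mulr_gt0 // -!natrM ler_nat.
  apply: leq_trans (ltnW (ltn_ceil n q0)) _; rewrite -/s mulnCA mulnA leq_mul2r.
  by apply/orP; right; move: s0; clear; lia.
(* By balance the exponent of [n] is at least [1 + d (#|S| - 1)], hence at least [1 + d]. *)
have bigpow (S : {set 'I_v}) : (1 < #|S|)%N ->
    kap ^+ v * n%:R `^ (1 + d) <= s%:R ^+ #|S| * p n ^+ #|bal_edges A B S|.
  move=> S1; have Sv : (#|S| <= v)%N by rewrite -[leqRHS]card_ord max_card.
  have dens : b * #|bal_edges A B S|%:R <= b * A%:R / B%:R * (#|S|%:R - 1).
    have S0 : S != finset.set0 by rewrite -card_gt0 ltnW.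
    have := bal_dense B0 AB S0; rewrite -(ler_nat R) !natrM -subn1 natrB 1?ltnW // => le.
    rewrite -!mulrA ler_wpM2l ?(ltW (lt_trans alpha0 ab)) //.
    by rewrite mulrCA ler_pdivlMl.
  apply: (@le_trans _ _ (kap ^+ #|S| * (n%:R ^+ #|S| * p n ^+ #|bal_edges A B S|))).
    apply: ler_pM; rewrite ?exprn_ge0 ?powR_ge0 ?(ltW kap0) //.
      by apply: ler_wiXn2l => //; apply: ltW.
    apply: (exp_le_powR _ pn) => //.
    have S2 : 2 <= #|S|%:R :> R by rewrite ler_nat.
    have : 0 <= d * (#|S|%:R - 2) by apply: mulr_ge0; [exact: ltW | rewrite subr_ge0].
    move: dens; rewrite /d; move: (b * A%:R / B%:R) (b * _) => u w; nra.
  rewrite mulrA -exprMn; apply: ler_wpM2r; first by rewrite exprn_ge0 // ltW.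
  by rewrite lerXn2r ?nnegrE ?ler0n //; apply: mulr_ge0; apply: ltW.
have FE S : induced_pairs F S = bal_edges A B S.
  by apply/setP => ij; rewrite !inE /= andbC andbA.
have N1d : n%:R `^ (1 + d) = n%:R * n%:R `^ d.
  by rewrite powRD ?powRr1 ?ler0n //; apply/implyP => _; rewrite gt_eqF.
have Nd : C <= n%:R `^ d.
  by rewrite -lef_pV2 ?posrE ?powR_gt0 // -powRN.
have kv0 : 0 < kap ^+ v by rewrite exprn_gt0.
have base : n%:R * (9 * 2 ^+ v) <= kap ^+ v * n%:R `^ (1 + d).
  rewrite N1d [leRHS]mulrCA ler_pM2l // [leRHS]mulrC.
  by move: Nd; rewrite /C ler_pdivrMr.
have two_v : 1 <= 2 ^+ v :> R by rewrite exprn_ege1 // ler1n.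
apply: (@le_trans _ _ (Pr (pairs n) (p n) (fun E => (v * max_chordal E + #|F| * (v * s) < #|F| * n)%N))).
  apply: le_Pr => // E _ lt; rewrite ltnNge; apply: contraTN lt => le; rewrite -leNgt.
  have Fv : #|F|%:R <= A%:R / B%:R * v%:R :> R.
    rewrite mulrAC ler_pdivlMr // -!natrM ler_nat mulnC.
    have S0 : [set: 'I_v] != finset.set0 by rewrite -card_gt0 cardsT card_ord.
    apply: leq_trans (bal_dense B0 AB S0) _; rewrite cardsT card_ord.
    by rewrite leq_mul2l leq_pred orbT.
  have := ratio_bal (bal_card_ge A B0 v) v0; rewrite -/F -/K => ratio.
  rewrite /Xn_over_n ler_pdivlMr // -(ler_pM2l vR).
  move: le; rewrite -(ler_nat R) natrD !natrM => le.
  have low : v%:R * (A%:R / B%:R - eps / 2) <= #|F|%:R.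
    by rewrite -ler_pdivlMl // mulrC; move: ratio vK; lra.
  have ms : #|F|%:R * s%:R <= n%:R * (eps / 4).
    apply: (@le_trans _ _ (A%:R / B%:R * v%:R * (n%:R / q%:R))).
      by apply: ler_pM => //; rewrite ler_pdivlMr // -natrM ler_nat.
    apply: le_trans (ler_wpM2l (ltW NR) qP).
    by rewrite le_eqVlt; apply/orP; left; apply/eqP; ring.
  have low' := ler_wpM2r (ltW NR) low.
  have ms' := ler_wpM2l (ltW vR) ms.
  have pos : 0 <= v%:R * n%:R * eps by rewrite !mulr_ge0 // ltW.
  move: le low' ms' pos; move: (A%:R / B%:R) (max_chordal E)%:R #|F|%:R n%:R v%:R s%:R; clear => *.
  lra.
have Flt i j : (i, j) \in F -> (i < j)%N by rewrite inE => /and3P[_ _ /andP[]].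
have Fcl i i' j : (i, j) \in F -> (i', j) \in F -> (i < i')%N -> (i, i') \in F.
  rewrite !inE /= => ij i'j ii'; exact: (bal_edge_lower B0 ij i'j ii').
have cle : (0 : R) <= 3 * n%:R <= s%:R ^+ v * p n ^+ #|F|.
  apply/andP; split; first exact: mulr_ge0.
  have := bigpow setT; rewrite cardsT card_ord => /(_ v2); apply: le_trans; apply: le_trans base.
  by rewrite mulrC ler_wpM2l //; move: two_v; lra.
have jan := max_chordal_janson n Flt Fcl p0 p1 s0 (leqnn (v * s)) cle.
apply: (le_trans jan).
set X := \sum_(S : {set 'I_v} | _) _.
have XN : (3 * n%:R) ^+ 2 * X <= n%:R.
  set D := kap ^+ v * n%:R `^ (1 + d) in base bigpow *.
  have D0 : 0 < D by rewrite mulr_gt0 ?powR_gt0.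
  have Xle : X <= 2 ^+ v / D.
    apply: (@le_trans _ _ (\sum_(S : {set 'I_v}) D^-1)).
      rewrite /X big_mkcond; apply: ler_sum => S _; case: ifP => [S1|_]; last by rewrite invr_ge0 ltW.
      have le := bigpow S S1; rewrite FE lef_pV2 ?posrE //.
      exact: lt_le_trans le.
    by rewrite sumr_const -[leLHS]mulr_natl -cardsT -powersetT card_powerset cardsT card_ord natrX.
  have le9 : 0 <= (3 * n%:R) ^+ 2 :> R by rewrite exprn_ge0 // mulr_ge0.
  apply: le_trans (ler_wpM2l le9 Xle) _.
  rewrite mulrA ler_pdivrMr //; have := ler_wpM2l (ltW NR) base; apply: le_trans.
  by rewrite le_eqVlt; apply/orP; left; apply/eqP; ring.
(* With [c = 3 n] the exponent is at most [- 2 n], and [expR 2 >= 4] beats the [2 ^+ n] of the union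
   bound. *)
apply: (@le_trans _ _ (2 ^+ n * expR (- (2 * n%:R)))).
  rewrite ler_wpM2l ?exprn_ge0 // ler_expR lerN2; move: XN; lra.
rewrite -mulNr expRM_natr -exprMn.
apply: (@le_trans _ _ ((2^-1 : R) ^+ n)).
  have e1 : 2 <= expR 1 :> R by apply: le_trans (expR_ge1Dx 1).
  have e2 : 4 <= expR 2 :> R.
    by rewrite (_ : (2:R) = 1 + 1) // expRD; move: e1; set y := expR 1 => e1; nra.
  rewrite lerXn2r ?nnegrE ?invr_ge0 // ?mulr_ge0 ?expR_ge0 // expRN.
  by rewrite ler_pdivrMr ?expR_gt0 //; lra.
near: n; have /cvgr0_norm_le : ((GRing.exp (2^-1 : R)) @ eventually --> 0)%classic.
  by apply: cvg_expr; rewrite ger0_norm // invf_lt1 // ltr1n.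
by move=> /(_ _ eta0); apply: filterS => n; apply: le_trans; apply: ler_norm.
Unshelve. all: by end_near.
Qed.

End Lower.
End Asymptotics.

(** * The two upper tails *)

Section UpperTails.
Context {R : realType}.
Variables (alpha : R) (p : nat -> R).
Hypotheses (p01 : forall n, 0 <= p n <= 1) (pexp : exponent_is p alpha).

Lemma near_exp_le (x eta : R) : 0 <= x < 1 -> 0 < eta -> \forall n \near eventually, x ^+ n <= eta.
Proof.
move=> /andP[x0 x1] eta0; have /cvgr0_norm_le : ((GRing.exp x) @ eventually --> 0)%classic.
  by apply: cvg_expr; rewrite ger0_norm.
by move=> /(_ _ eta0); apply: filterS => n; apply: le_trans; apply: ler_norm.
Qed.

Lemma exponent_near_le a : a < alpha -> \forall n \near eventually, p n <= n%:R `^ (- a).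
Proof.
move=> aa; have := exponent_near pexp (_ : a < alpha < alpha + 1).
by rewrite aa ltrDl ltr01 => /(_ isT); apply: filterS => n /andP[].
Qed.

Lemma upper_tail_first_moment eps eta : 0 < alpha -> 0 < eps -> 0 < eta ->
  \forall n \near eventually,
    Pr (pairs n) (p n) (fun E => 1 / alpha + eps < Xn_over_n R E) <= eta.
Proof.
move=> alpha0 eps0 eta0; set x0 := 1 / alpha + eps.
have x00 : 0 < x0 by rewrite addr_gt0 // divr_gt0.
have xa : x0^-1 < alpha.
  by rewrite -[ltRHS]invrK ltf_pV2 ?posrE ?invr_gt0 // /x0 div1r ltrDl.
pose a := (x0^-1 + alpha) / 2.
have aa : a < alpha by rewrite midf_lt.
have a0 : 0 < a by apply: lt_trans (_ : x0^-1 < a); rewrite ?invr_gt0 ?midf_lt.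
have ax : 1 < a * x0 by rewrite -ltr_pdivrMr // div1r midf_lt.
pose d := a * x0 - 1.
have d0 : 0 < d by rewrite subr_gt0.
have [u [u0 au]] : exists u, (0 < u)%N /\ 2 <= a * u%:R.
  have [m _ mP] := nbhs_infty_ger (2 / a).
  exists (maxn m 1); split; first by rewrite leq_max orbT.
  by have := mP (maxn m 1) (leq_maxl _ _) => /=; rewrite ler_pdivrMr // mulrC.
have eta2 : 0 < eta / 2 by rewrite divr_gt0.
near=> n.
have n0 : (0 < n)%N by near: n; exists 1%N.
have N1 : 1 <= n%:R :> R by rewrite ler1n.
have NR : 0 < n%:R :> R by rewrite ltr0n.
have pn : 0 <= p n <= n%:R `^ (- a).
  by apply/andP; split; [case/andP: (p01 n)|near: n; apply: exponent_near_le].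
have small1 : n%:R `^ (- 1) <= eta / 2 by near: n; apply: near_powR_le.
(* The union over narrow graphs is at most the [n]-th power of [2 ^ (2 u + 1) n ^ (- d)], which
   becomes at most [1/2]. *)
have small2 : n%:R `^ (- d) <= (2 ^+ u.*2.+2)^-1.
  by near: n; apply: near_powR_le => //; rewrite invr_gt0 exprn_gt0.
have small3 : 2^-1 ^+ n <= eta / 2.
  by near: n; apply: near_exp_le => //; rewrite invr_ge0 ler0n invf_lt1 // ltr1n.
pose m := (Num.trunc (x0 * n%:R)).+1.
have xn0 : 0 <= x0 * n%:R by rewrite mulr_ge0 // ltW.
have /andP[tr1 tr2] := truncn_itv xn0.
apply: (@le_trans _ _ (Pr (pairs n) (p n) (fun E => (m <= max_chordal E)%N))).
  apply: le_Pr => // E _; rewrite /Xn_over_n ltr_pdivlMr // => lt.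
  by rewrite -(ltr_nat R) (le_lt_trans tr1).
apply: le_trans (Pr_max_chordal_ge (p01 n) u.*2 m) _.
rewrite (splitr eta); apply: lerD.
  apply: le_trans small1; apply: (powR_le_exp n0 pn).
  have -> : 'C(u.*2.+1, 2) = (u.*2.+1 * u)%N.
    by rewrite bin2 /= -doubleMr doubleK.
  rewrite natrM mulrCA -[X in X - _]mulr1 -mulrBr.
  have : 1 <= u.*2.+1%:R :> R by rewrite ler1n.
  by move: au; move: (a * _) (u.*2.+1%:R : R) => y z; nra.
apply: le_trans small3.
apply: (@le_trans _ _ ((n%:R * 2 ^+ u.*2.+1) ^+ n * (n%:R `^ (- (1 + d))) ^+ n)).
  apply: ler_pM; rewrite ?exprn_ge0 //; first by case/andP: pn.
    rewrite lerXn2r ?nnegrE ?mulr_ge0 ?exprn_ge0 // -natrX -natrM ler_nat expnS.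
    have : (0 < n * 2 ^ u.*2)%N by rewrite muln_gt0 n0 expn_gt0.
    by rewrite mulnCA; move: (n * 2 ^ u.*2)%N; clear; lia.
  apply: (@le_trans _ _ ((n%:R `^ (- a)) ^+ m)).
    by case/andP: pn => ? ?; rewrite lerXn2r // nnegrE powR_ge0.
  rewrite -!powR_mulrn ?powR_ge0 // -!powRrM ler_powR // !mulNr lerN2.
  rewrite /d addrC subrK -mulrA ler_wpM2l ?(ltW a0) //; exact: ltW.
rewrite -exprMn lerXn2r ?nnegrE ?mulr_ge0 ?exprn_ge0 ?powR_ge0 ?invr_ge0 //.
rewrite opprD powRD; last by apply/implyP => _; rewrite gt_eqF.
rewrite powR_inv1 // mulrACA mulfV ?gt_eqF // mul1r.
apply: (@le_trans _ _ (2 ^+ u.*2.+1 * (2 ^+ u.*2.+2)^-1)).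
  by rewrite ler_wpM2l ?exprn_ge0.
by rewrite [in (_ ^+ _)^-1]exprS invfM mulrCA mulfV ?mulr1 //.
Unshelve. all: by end_near.
Qed.

Lemma upper_tail_clusters k eps eta : k.+2%:R / k.*2.+3%:R < alpha -> 0 < eps -> 0 < eta ->
  \forall n \near eventually,
    Pr (pairs n) (p n) (fun E => k.*2.+1%:R / k.+1%:R + eps < Xn_over_n R E) <= eta.
Proof.
move=> ka eps0 eta0; have eta2 : 0 < eta / 2 by rewrite divr_gt0.
pose a := (k.+2%:R / k.*2.+3%:R + alpha) / 2.
have aa : a < alpha by rewrite midf_lt.
have ak : k.+2%:R < a * k.*2.+3%:R by rewrite -ltr_pdivrMr // midf_lt.
have k3 : k.*2.+3%:R = 2 * k.+2%:R - 1 :> R.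
  by apply/eqP; rewrite eq_sym subr_eq -natrM -(natrD _ _ 1) eqr_nat; apply/eqP; clear; lia.
have a1 : 1 < 2 * a.
  move: ak; rewrite k3; have : 2 <= k.+2%:R :> R by rewrite ler_nat.
  by move: (k.+2%:R : R) => y; nra.
pose d := Num.min (2 * a - 1) (a * k.*2.+3%:R - k.+2%:R).
have d0 : 0 < d by rewrite lt_min !subr_gt0 a1.
(* Equivalent to [V0 - a (2 V0 - 3) <= -1], so that dense sets of size [V0] are unlikely. *)
have [V0 [V01 V0a]] : exists V0, (1 < V0)%N /\ 3 * a + 1 <= V0%:R * (2 * a - 1).
  have [m _ mP] := nbhs_infty_ger ((3 * a + 1) / (2 * a - 1)).
  exists (maxn m 2); split; first by rewrite leq_max orbT.
  by have := mP (maxn m 2) (leq_maxl _ _) => /=; rewrite ler_pdivrMr // subr_gt0.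
have V0R : 0 < V0%:R :> R by rewrite ltr0n ltnW.
pose C1 : R := 2 ^+ 'C(V0, 2).
pose C2 : R := \sum_(s < V0 | (1 < s)%N) 2 ^+ 'C(s, 2).
have C10 : 0 < C1 by rewrite exprn_gt0.
have C20 : 0 <= C2 by apply: sumr_ge0 => s _; rewrite exprn_ge0.
pose C3 := V0%:R ^+ 2 / eps * (C2 + 1).
have C30 : 0 < C3 by rewrite mulr_gt0 ?divr_gt0 ?exprn_gt0 // ltr_wpDl.
(* Both branches decrease in [s] as [2 a > 1]; the worst cases [s = 2] and [s = k + 3] are the two
   terms of the minimum [d]. *)
have expo s : (1 < s)%N -> s%:R - a * (dense_edges k s)%:R <= 1 - d.
  have dle : d <= 2 * a - 1 /\ d <= a * k.*2.+3%:R - k.+2%:R by rewrite !ge_min !lexx orbT.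
  move: dle; rewrite k3; move: (d) => d' [d1 d2] s1; rewrite /dense_edges.
  have s2 : 2 <= s%:R :> R by rewrite ler_nat.
  case: leqP => sk.
    rewrite -[s.*2.-2]subn2 natrB; last by clear -s1; lia.
    rewrite -muln2 natrM; move: d1 s2 a1; move: (s%:R : R); clear => *; nra.
  rewrite natrB; last by clear -s1; lia.
  have sk' : k.+2%:R + 1 <= s%:R :> R by rewrite -(natrD _ _ 1) ler_nat addn1.
  rewrite -muln2 natrM; move: d2 sk' a1; move: (s%:R : R) (k.+2%:R : R); clear => *; nra.
near=> n.
have n0 : (0 < n)%N by near: n; exists 1%N.
have NR : 0 < n%:R :> R by rewrite ltr0n.
have pn : 0 <= p n <= n%:R `^ (- a).
  by apply/andP; split; [case/andP: (p01 n)|near: n; apply: exponent_near_le].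
have small1 : n%:R `^ (- 1) <= eta / 2 / C1.
  by near: n; apply: near_powR_le; rewrite // divr_gt0.
have small2 : n%:R `^ (- d) <= eta / 2 / C3.
  by near: n; apply: near_powR_le; rewrite // divr_gt0.
(* This many exceptional clusters, with [V0 ^ 2] edges each, use up exactly [eps * n] edges. *)
pose x := eps * n%:R / V0%:R ^+ 2.
have x0 : 0 < x by rewrite divr_gt0 ?exprn_gt0 // mulr_gt0.
apply: le_trans (_ : _ <= Pr (pairs n) (p n) (fun E => k.*2.+1%:R * n%:R + k.+1%:R * V0%:R ^+ 2 * x < k.+1%:R * (max_chordal E)%:R)) _.
  apply: le_Pr => // E _; rewrite /Xn_over_n ltr_pdivlMr // => lt.
  rewrite -[X in X < _](_ : k.+1%:R * ((k.*2.+1%:R / k.+1%:R + eps) * n%:R) = _); first by rewrite ltr_pM2l.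
  by rewrite /x; field; rewrite !gt_eqF.
apply: le_trans (Pr_max_chordal_dense (p01 n) k V01 x0) _.
rewrite (splitr eta); apply: lerD.
  rewrite mulrCA -/C1 mulrC -ler_pdivlMr //; apply: le_trans small1.
  apply: (powR_le_exp n0 pn); rewrite natrB; last by clear -V01; lia.
  rewrite -muln2 natrM; move: V0a; move: (V0%:R : R); clear => *; lra.
apply: (@le_trans _ _ (x^-1 * (C2 * n%:R `^ (1 - d)))).
  rewrite ler_wpM2l ?invr_ge0 ?(ltW x0) // mulr_suml; apply: ler_sum => s s1.
  by rewrite mulrCA ler_wpM2l ?exprn_ge0 // (powR_le_exp n0 pn) // expo.
rewrite powRD; last by apply/implyP => _; rewrite gt_eqF.
rewrite powRr1 ?ler0n //; apply: (@le_trans _ _ (C3 * n%:R `^ (- d))); last first.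
  by rewrite mulrC -ler_pdivlMr.
rewrite (_ : x^-1 * _ = V0%:R ^+ 2 / eps * C2 * n%:R `^ (- d)); last first.
  by rewrite /x; field; rewrite !gt_eqF.
rewrite ler_wpM2r ?powR_ge0 // ler_wpM2l ?lerDl //.
by rewrite divr_ge0 ?exprn_ge0 // ltW.
Unshelve. all: by end_near.
Qed.

Lemma cvg_in_prob_tails c :
  (forall eps eta, 0 < eps -> 0 < eta -> \forall n \near eventually,
    Pr (pairs n) (p n) (fun E => c + eps < Xn_over_n R E) <= eta) ->
  (forall eps eta, 0 < eps -> 0 < eta -> \forall n \near eventually,
    Pr (pairs n) (p n) (fun E => Xn_over_n R E < c - eps) <= eta) ->
  cvg_in_prob_gnp p (@Xn_over_n R) c.
Proof.
move=> up low eps eps0; apply/cvgr0Pnorm_le => eta eta0.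
have eta2 : 0 < eta / 2 by rewrite divr_gt0.
have := low _ _ eps0 eta2; have := up _ _ eps0 eta2; apply: filterS2 => n upn lown.
rewrite gnp_probE ger0_norm ?Pr_ge0 // (splitr eta); apply: le_trans (lerD upn lown).
apply: le_trans (PrU_le _ _ _ (p01 n)); apply: le_Pr => // E _.
by rewrite ltr_normr => /orP[lt|lt]; apply/orP; [left|right]; move: lt; lra.
Qed.

End UpperTails.

Theorem theorem2 (R : realType) (alpha : R) (p : nat -> R) :
  0 < alpha ->
  (forall n : nat, 0 <= p n <= 1) ->
  exponent_is p alpha ->
  (* (1) *)
  ((1 / 2 < alpha <= 1) ->
   (forall k : nat, alpha != (1 + k%:R) / (1 + 2 * k%:R)) ->
   forall k_alpha : nat,
     alpha < (1 + k_alpha%:R) / (1 + 2 * k_alpha%:R) ->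
     (forall k : nat, alpha < (1 + k%:R) / (1 + 2 * k%:R) -> (k <= k_alpha)%N) ->
     cvg_in_prob_gnp p (@Xn_over_n R)
       ((1 + 2 * k_alpha%:R) / (1 + k_alpha%:R)))
  /\
  (* (2) *)
  (alpha <= 1 / 2 -> cvg_in_prob_gnp p (@Xn_over_n R) (1 / alpha)).
Proof.
move=> alpha0 p01 pexp; split.
  move=> _ alphaN k ak kmax.
  have kS : 1 + k%:R = k.+1%:R :> R by rewrite nat1r.
  have k2S : 1 + 2 * k%:R = k.*2.+1%:R :> R by rewrite -natrM nat1r mul2n.
  rewrite kS k2S in ak *.
  apply: cvg_in_prob_tails => // eps eta eps0 eta0.
    apply: (upper_tail_clusters p01 pexp _ eps0 eta0).
    (* Maximality of [k] gives the weak inequality at [k + 1], and the excluded values of [alpha]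
       make it strict. *)
    rewrite lt_neqAle leNgt; apply/andP; split.
      have := alphaN k.+1; rewrite eq_sym nat1r -natrM nat1r.
      by rewrite (_ : (2 * k.+1).+1 = k.*2.+3)%N // mul2n doubleS.
    apply/negP => lt; have := kmax k.+1; rewrite ltnn nat1r -natrM nat1r.
    by rewrite (_ : (2 * k.+1).+1 = k.*2.+3)%N ?mul2n ?doubleS // => /(_ lt).
  apply: (lower_tail _ _ alpha0 p01 pexp _ eps0 eta0) => //.
  by rewrite -ltr_pdivlMr.
move=> alpha_half; apply: cvg_in_prob_tails => // eps eta eps0 eta0.
  exact: upper_tail_first_moment.
have [B [B0 BP]] : exists B, (0 < B)%N /\ 2 / eps <= B%:R.
  have [m _ mP] := nbhs_infty_ger (2 / eps).
  exists (maxn m 1); split; first by rewrite leq_max orbT.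
  exact: (mP (maxn m 1) (leq_maxl _ _)).
have BR : 0 < B%:R :> R by rewrite ltr0n.
(* [A] is the largest integer strictly below [B / alpha]: the truncation, or one less if [B / alpha]
   is an integer. Then [A / B] is within [1 / B <= eps / 2] of [1 / alpha]. *)
have [A [A1 A2]] : exists A : nat, alpha * A%:R < B%:R /\ B%:R <= alpha * A.+1%:R.
  have b0 : 0 <= B%:R / alpha by rewrite divr_ge0 // ltW.
  have /andP[t1 t2] := truncn_itv b0; move: t1 t2; set T := Num.trunc _.
  rewrite ler_pdivlMr // ltr_pdivrMr // ![_ * alpha]mulrC => t1 t2.
  have [lt|ge] := ltP (alpha * T%:R) B%:R; first by exists T; split=> //; apply: ltW.
  case: T t1 t2 ge => [|T] t1 t2 ge; first by move: ge; rewrite mulr0 leNgt BR.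
  exists T; split=> //; apply: lt_le_trans t1; by rewrite ltr_pM2l // ltr_nat.
have AB : (B.*2 <= A.+1)%N.
  rewrite -(ler_nat R) -muln2 natrM -ler_pdivlMr // (le_trans A2) // mulrC ler_wpM2l //.
  by move: alpha_half; lra.
have eps2 : 0 < eps / 2 by rewrite divr_gt0.
have := lower_tail B0 AB alpha0 p01 pexp A1 eps2 eta0; apply: filterS => n.
apply: le_trans; apply: le_Pr => // E _ /lt_le_trans; apply.
have : 1 / alpha - eps / 2 <= A%:R / B%:R.
  rewrite ler_pdivlMr // mulrBl lerBlDr.
  have : 1 <= eps / 2 * B%:R by move: BP; rewrite ler_pdivrMr //; lra.
  have : 1 / alpha * B%:R <= A.+1%:R by rewrite mulrC mulrA mulr1 ler_pdivrMr // mulrC.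
  by rewrite -natr1; lra.
lra.
Qed.
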